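(* In the setting of the context (Hausdorff spaces $X_1,X_2$, entropy functions $F_1,F_2\in\Gamma(\mathbb R_+)$, proper lower semicontinuous cost $c:X_1\times X_2\to[0,+\infty]$, measures $\mu_i\in\mathcal M(X_i)$ satisfying the compatibility condition), assume that the Entropy-Transport problem is feasible, i.e. there exists $\gamma\in\mathcal M(X_1\times X_2)$ with $\mathscr E(\gamma|\mu_1,\mu_2)<\infty$, and that at least one of the following two conditions holds: (i) $F_1$ and $F_2$ are superlinear, i.e. $(F_1)'_\infty=(F_2)'_\infty=+\infty$; (ii) $c$ has compact sublevels in $X_1\times X_2$ and $(F_1)'_\infty+(F_2)'_\infty+\inf c>0$. Then the problem of minimizing $\mathscr E(\cdot|\mu_1,\mu_2)$ over $\mathcal M(X_1\times X_2)$ admits at least one solution, and the set $\mathrm{Opt}_{\mathsf{ET}}(\mu_1,\mu_2)$ of all minimizers is a compact (for the narrow topology) convex subset of $\mathcal M(X_1\times X_2)$.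
   Context: For a Hausdorff space $X$, $\mathcal M(X)$ is the set of finite nonnegative Radon measures (finite Borel measures $\mu$ such that for every Borel $B$ and $\varepsilon>0$ there is a compact $K\subset B$ with $\mu(B\setminus K)\le\varepsilon$). The narrow topology on $\mathcal M(X)$ is the coarsest topology making $\mu\mapsto\int\varphi\,d\mu$ lower semicontinuous for every bounded lower semicontinuous $\varphi:X\to\mathbb R$. $\Gamma(\mathbb R_+)$ is the set of convex lower semicontinuous $F:[0,\infty)\to[0,\infty]$ with $\mathrm{Dom}(F)\cap(0,\infty)\ne\emptyset$, where $\mathrm{Dom}(F)=\{s\ge0:F(s)<\infty\}$. The recession constant is $F'_\infty=\lim_{s\to\infty}F(s)/s$. For $\gamma,\mu\in\mathcal M(X)$ with Lebesgue decomposition $\gamma=\sigma\mu+\gamma^\perp$, $\gamma^\perp\perp\mu$, set $\mathscr F(\gamma|\mu)=\int_XF(\sigma)\,d\mu+F'_\infty\,\gamma^\perp(X)$, with $0\cdot\infty=0$. Basic setting: $X_1,X_2$ Hausdorff spaces, $F_1,F_2\in\Gamma(\mathbb R_+)$, $c:X_1\times X_2\to[0,+\infty]$ lower semicontinuous and not identically $+\infty$, $\mu_i\in\mathcal M(X_i)$ with $m_i=\mu_i(X_i)$ satisfying the compatibility condition $\big(m_1\mathrm{Dom}(F_1)\big)\cap\big(m_2\mathrm{Dom}(F_2)\big)\neq\emptyset$. For $\gamma\in\mathcal M(X_1\times X_2)$ with marginals $\gamma_i=\pi^i_\sharp\gamma$, $$\mathscr E(\gamma|\mu_1,\mu_2)=\mathscr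 F_1(\gamma_1|\mu_1)+\mathscr F_2(\gamma_2|\mu_2)+\int_{X_1\times X_2}c\,d\gamma,$$ where $\mathscr F_i$ is the functional associated with $F_i$. *)

(* Defs.v *)
From HB Require Import structures.
From mathcomp Require Import all_boot all_order all_algebra.
From mathcomp Require Import all_classical all_reals all_analysis.
From mathcomp Require Import finmap measurable_realfun.

Set Implicit Arguments.
Unset Strict Implicit.
Unset Printing Implicit Defensive.

Import Order.TTheory GRing.Theory Num.Theory.
Import numFieldNormedType.Exports.

Local Open Scope classical_set_scope.
Local Open Scope ring_scope.
Local Open Scope ereal_scope.

(* The product of pointed topological spaces, with the product topology; the
   library does not declare this join of its existing structures. *)
HB.instance Definition _ (X Y : ptopologicalType) := Pointed.on (X * Y)%type.

(* The space with its Borel sigma-algebra. For a product X1 * X2 this is the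
   sigma-algebra generated by the open sets of the product topology, which may
   be strictly larger than the product of the two Borel sigma-algebras.
   measurableType asks for a base point, hence ptopologicalType; this excludes
   only the empty space. *)
Notation borel X := (g_sigma_algebraType (@open X%type)).

Lemma open_borel_measurable (X : ptopologicalType) (U : set X) :
  open U -> measurable (U : set (borel X)).
Proof. by move=> oU; exact: sub_gen_smallest. Qed.

Lemma continuous_borel_measurable (X Y : ptopologicalType) (f : X -> Y) :
  continuous f -> measurable_fun [set: borel X] (f : borel X -> borel Y).
Proof.
move=> cf; refine (@measurability _ _ (borel X) (borel Y)
  setT f (@open Y) erefl _) => _ [B oB <-].
rewrite setTI; apply: open_borel_measurable.
by apply: open_comp => // x _; exact: cf.
Qed.

Section finite_measure_add.
Context d (T : measurableType d) (R : realType).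
Variables m1 m2 : {finite_measure set T -> \bar R}.

Let fin_num_add : fin_num_fun (measure_add m1 m2).
Proof.
by move=> A mA; rewrite measure_addE fin_numD !fin_num_measure.
Qed.

HB.instance Definition _ := Measure.copy (measure_add m1 m2)
  (msum (fun n => if n is 0%N then (m1 : {measure set T -> \bar R}) else m2) 2).
HB.instance Definition _ :=
  @Measure_isFinite.Build _ T _ (measure_add m1 m2) fin_num_add.

End finite_measure_add.

Section radon.
Context {R : realType} {X : ptopologicalType}.

(* In a Hausdorff space compact sets are closed, so B `\` K is Borel. *)
Definition is_radon (mu : set (borel X) -> \bar R) :=
  forall (B : set X) (eps : R), measurable (B : set (borel X)) -> (0 < eps)%R ->
  exists K : set X, [/\ compact K, K `<=` B & mu (B `\` K) <= eps%:E].

End radon.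

(* Two elements that agree on all Borel sets may still differ, as functions,
   on non-Borel sets. This is immaterial: such elements are topologically
   indistinguishable for the narrow topology below, and all functionals below
   take the same value at them. *)
Record radon_measure (R : realType) (X : ptopologicalType) := RadonMeasure {
  radon_fmeas :> {finite_measure set (borel X) -> \bar R} ;
  radon_measureP : is_radon radon_fmeas }.

Section narrow_topology.
Context (R : realType) (X : ptopologicalType).
Notation M := (radon_measure R X).

HB.instance Definition _ := gen_eqMixin M.
HB.instance Definition _ := gen_choiceMixin M.

(* mu |-> \int phi d mu is lower semicontinuous iff the sets
   [set mu | a < \int phi d mu] are open, see lower_semicontinuousP. *)
Definition narrow_subbase : set (set M) :=
  [set U | exists (phi : X -> R) (a : R),
    [/\ (exists C : R, forall x, (`|phi x| <= C)%R),
        lower_semicontinuous (EFin \o phi) &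
        U = [set mu : M | a%:E < \int[mu]_(x in [set: borel X]) (phi x)%:E]]].

HB.instance Definition _ :=
  isSubBaseTopological.Build M narrow_subbase id.

Lemma narrow_integral_lsc (phi : X -> R) :
  (exists C : R, forall x, (`|phi x| <= C)%R) ->
  lower_semicontinuous (EFin \o phi) ->
  lower_semicontinuous
    (fun mu : M => \int[mu]_(x in [set: borel X]) (phi x)%:E).
Proof.
move=> phib phil; apply/lower_semicontinuousP => a.
pose U := [set mu : M | a%:E < \int[mu]_(x in [set: borel X]) (phi x)%:E].
exists [set U]; last by rewrite bigcup_set1.
move=> _ ->; exists [fset U]%fset; last by rewrite set_fset1 bigcap_set1.
by move=> i /[!inE] /eqP ->; apply: mem_set; exists phi, a.
Qed.

End narrow_topology.

Section lebesgue_decomposition.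
Context d (T : measurableType d) (R : realType).

Definition mutually_singular (m1 m2 : set T -> \bar R) :=
  exists N, [/\ measurable N, m1 (~` N) = 0 & m2 N = 0].

Definition is_lebesgue_decomposition (gamma mu : set T -> \bar R)
    (p : (T -> R) * {finite_measure set T -> \bar R}) :=
  [/\ measurable_fun [set: T] p.1, (forall x, 0 <= p.1 x)%R,
      mutually_singular p.2 mu &
      forall A, measurable A ->
        gamma A = \int[mu]_(x in A) (p.1 x)%:E + p.2 A].

Lemma lebesgue_decomposition_exists
    (gamma mu : {finite_measure set T -> \bar R}) :
  exists p, is_lebesgue_decomposition gamma mu p.
Proof.
pose la : {finite_measure set T -> \bar R} := measure_add gamma mu.
have laE A : la A = gamma A + mu A by exact: measure_addE.
have mu_la : mu `<< la.
  apply/null_content_dominatesP => A mA laA0; have := laE A.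
  rewrite [la A]laA0 => /esym/eqP.
  by rewrite padde_eq0// => /andP[_ /eqP].
have [h [h0 hfin hint hE]] := radon_nikodym_sigma_finite mu_la.
have mh : measurable_fun setT h by case/integrableP : hint.
pose N := [set x | h x = 0].
have mN : measurable N.
  by rewrite -[X in measurable X]setTI; exact: (mh measurableT [set 0]).
have muN : mu N = 0.
  by rewrite hE//; apply: integral0_eq => x; exact.
have mNc : measurable (~` N) by exact: measurableC.
pose ga : {finite_measure set T -> \bar R} := mrestr gamma mNc.
pose gs : {finite_measure set T -> \bar R} := mrestr gamma mN.
have ga_mu : ga `<< mu.
  apply/null_content_dominatesP => A mA muA0.
  have mANc : measurable (A `&` ~` N) by exact: measurableI.
  have muANc : mu (A `&` ~` N) = 0.
    by apply: subset_measure0 muA0 => //; exact: subIsetl.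
  have : \int[la]_(x in A `&` ~` N) `|h x| = 0.
    by under eq_integral do rewrite gee0_abs//; rewrite -hE.
  move/(ae_eq_integral_abs la mANc (measurable_funTS mh)) => [Z [mZ laZ sZ]].
  have laANc : la (A `&` ~` N) = 0.
    apply: subset_measure0 laZ => //.
    by move=> x /= [Ax Nx]; apply: sZ => /= /(_ (conj Ax Nx)).
  move: laANc; rewrite laE => /eqP.
  by rewrite padde_eq0// => /andP[/eqP].
have [f [f0 ffin fint fE]] := radon_nikodym_sigma_finite ga_mu.
exists (fine \o f, gs); split => /=.
- by apply: measurableT_comp => //; case/integrableP : fint.
- by move=> x; exact: fine_ge0.
- by exists N; split=> //; rewrite /gs/= /mrestr setICl measure0.
- move=> A mA; under eq_integral do rewrite fineK//.
  rewrite -fE// /ga /gs/= /mrestr addeC -measureU//; last 3 first.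
  + exact: measurableI.
  + exact: measurableI.
  + by rewrite setIACA setICr setI0.
  by rewrite -setIUr setUv setIT.
Qed.

(* The density is unique up to mu-null sets and the singular part is unique on
   measurable sets. *)
Definition lebesgue_decomposition
    (gamma mu : {finite_measure set T -> \bar R}) :=
  sval (cid (lebesgue_decomposition_exists gamma mu)).

Lemma lebesgue_decompositionP (gamma mu : {finite_measure set T -> \bar R}) :
  is_lebesgue_decomposition gamma mu (lebesgue_decomposition gamma mu).
Proof. by rewrite /lebesgue_decomposition; case: cid. Qed.

Definition leb_density (gamma mu : {finite_measure set T -> \bar R}) : T -> R :=
  (lebesgue_decomposition gamma mu).1.

Definition leb_singular (gamma mu : {finite_measure set T -> \bar R}) :
    {finite_measure set T -> \bar R} :=
  (lebesgue_decomposition gamma mu).2.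

End lebesgue_decomposition.

Section entropy.
Context {R : realType}.
Implicit Types F : R -> \bar R.

(* An entropy function is only meaningful on [0, +oo[; its values at negative
   reals are never used. In subspace A the points outside of A are isolated, so
   that lower semicontinuity there is lower semicontinuity of the restriction
   to A. *)
Record is_entropy_function F : Prop := IsEntropyFunction {
  entropy_ge0 : forall s : R, (0 <= s)%R -> 0 <= F s ;
  entropy_convex : forall t s1 s2 : R,
    (0 <= t <= 1)%R -> (0 <= s1)%R -> (0 <= s2)%R ->
    F (t * s1 + (1 - t) * s2)%R <= t%:E * F s1 + (1 - t)%:E * F s2 ;
  entropy_lsc :
    lower_semicontinuous (F : subspace `[0%R, +oo[%classic -> \bar R) ;
  entropy_proper : exists s : R, (0 < s)%R /\ F s < +oo }.

Definition entropy_dom F : set R := [set s | (0 <= s)%R /\ F s < +oo].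

Definition recession F : \bar R := lim (F s * (s^-1)%:E @[s --> +oo%R]).

Definition entropy_functional d (T : measurableType d) F
    (gamma mu : {finite_measure set T -> \bar R}) : \bar R :=
  \int[mu]_x F (leb_density gamma mu x) +
  recession F * leb_singular gamma mu [set: T].

End entropy.

Section continuous_image.
Context {R : realType} {X Y : ptopologicalType} (f : X -> Y) (cf : continuous f).
Variable gamma : {finite_measure set (borel X) -> \bar R}.

Definition continuous_image & continuous f : set (borel Y) -> \bar R :=
  pushforward gamma (f : borel X -> borel Y).

Local Notation image := (continuous_image cf).

Let mf := continuous_borel_measurable cf.

Let mpre (A : set (borel Y)) : measurable A ->
  measurable (f @^-1` A : set (borel X)).
Proof. by move=> mA; rewrite -[X in measurable X]setTI; exact: mf. Qed.

Let image0 : image set0 = 0.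
Proof. by rewrite /continuous_image /pushforward preimage_set0 measure0. Qed.

Let image_ge0 A : 0 <= image A. Proof. exact: measure_ge0. Qed.

Let image_sigma_additive : semi_sigma_additive image.
Proof.
move=> A mA tA mUA; rewrite /continuous_image /pushforward preimage_bigcup.
apply: measure_semi_sigma_additive.
- by move=> n; exact: mpre.
- by apply/trivIsetP => i j _ _ ij; rewrite -preimage_setI;
    move/trivIsetP : tA => /(_ _ _ I I ij) ->; rewrite preimage_set0.
- by rewrite -preimage_bigcup; exact: mpre.
Qed.

HB.instance Definition _ := isMeasure.Build _ _ _ image
  image0 image_ge0 image_sigma_additive.

Let image_fin : fin_num_fun image.
Proof. by move=> A mA; apply: fin_num_measure; exact: mpre. Qed.

HB.instance Definition _ := @Measure_isFinite.Build _ _ _ image image_fin.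

End continuous_image.

Lemma continuous_fst (X1 X2 : ptopologicalType) :
  continuous (fst : X1 * X2 -> X1).
Proof. by move=> x; exact: cvg_fst. Qed.

Lemma continuous_snd (X1 X2 : ptopologicalType) :
  continuous (snd : X1 * X2 -> X2).
Proof. by move=> x; exact: cvg_snd. Qed.

Section marginals.
Context {R : realType} {X1 X2 : ptopologicalType}.
Implicit Type gamma : {finite_measure set (borel (X1 * X2)) -> \bar R}.

Definition marginal1 gamma : {finite_measure set (borel X1) -> \bar R} :=
  continuous_image gamma (@continuous_fst X1 X2).

Definition marginal2 gamma : {finite_measure set (borel X2) -> \bar R} :=
  continuous_image gamma (@continuous_snd X1 X2).

End marginals.

Section entropy_transport.
Context {R : realType} {X1 X2 : ptopologicalType}.
Variables (F1 F2 : R -> \bar R) (c : X1 * X2 -> \bar R).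
Variables (mu1 : radon_measure R X1) (mu2 : radon_measure R X2).

Definition compatible : Prop :=
  [set fine (mu1 [set: X1]) * s | s in entropy_dom F1]%R `&`
  [set fine (mu2 [set: X2]) * s | s in entropy_dom F2]%R !=set0.

Definition ET_functional (gamma : radon_measure R (X1 * X2)%type) : \bar R :=
  entropy_functional F1 (marginal1 gamma) mu1 +
  entropy_functional F2 (marginal2 gamma) mu2 +
  \int[gamma]_(x in [set: borel (X1 * X2)]) c x.

Definition ET_opt : set (radon_measure R (X1 * X2)%type) :=
  [set gamma | forall gamma', ET_functional gamma <= ET_functional gamma'].

End entropy_transport.

(* The combination t mu + (1 - t) nu, as a Borel measure, belongs to A. *)
Definition convex_measures {R : realType} {X : ptopologicalType}
    (A : set (radon_measure R X)) : Prop :=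
  forall (t : R) (mu nu : radon_measure R X), (0 <= t <= 1)%R -> A mu -> A nu ->
  exists2 la : radon_measure R X, A la &
    forall B : set (borel X), measurable B ->
      la B = t%:E * mu B + (1 - t)%:E * nu B.

Definition compact_sublevels {R : realType} {X : topologicalType}
    (f : X -> \bar R) : Prop :=
  forall a : R, compact [set x | f x <= a%:E].

(* Main.v *)
Require Import Defs.
From HB Require Import structures.
From mathcomp Require Import all_boot all_order all_algebra.
From mathcomp Require Import all_classical all_reals all_analysis.
From mathcomp Require Import finmap measurable_realfun ring lra.

Set Implicit Arguments.
Unset Strict Implicit.
Unset Printing Implicit Defensive.

Import Order.TTheory GRing.Theory Num.Theory.
Import numFieldNormedType.Exports.

Local Open Scope classical_set_scope.
Local Open Scope ring_scope.
Local Open Scope ereal_scope.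

(** The proof is the direct method, run with ultrafilters instead of sequences
    because the narrow topology of a general Hausdorff space need not be
    sequential.

    Sublevel sets of the functional are bounded in mass and tight ([ET_mass],
    [ET_tight]). An affine minorant [a s + b] of [F] with [a > 0] turns a bound
    on the entropy of [gamma] into a bound on [gamma A] in terms of [mu A];
    when [F] is superlinear, [a] can be taken so large that the tightness of
    [mu] passes to [gamma]. When the cost has compact sublevels, these are the
    compact sets required, by Markov's inequality.

    Hence an ultrafilter [U] that contains a sublevel set converges. Its limit
    is built from the lower limits of masses of open sets along [U]: they are
    additive because [U] is an ultrafilter, and regularizing them, first from
    outside by open sets and then from inside by compact sets, gives a Radon
    measure ([radon_of_content], [prokhorov_ultra]). Compact sets of a
    Hausdorff space can be separated by open sets, and no further separation
    property enters. This limit satisfies the two inequalities of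
    [portmanteau_limit], which imply narrow convergence ([portmanteau_cvg]).

    The functional is lower semicontinuous along such limits. The cost term is
    approximated from below by sums of indicators of open sets. For the
    entropy, [F] is the supremum of countably many affine minorants [a s + b],
    and the recession constant is the supremum of their slopes. Therefore the
    entropy of [gamma] with respect to [mu] is the least total value of a
    superadditive set function [m] such that [a gamma A + b mu A <= m A] for
    all minorants and all Borel sets [A] ([entropy_on_ge],
    [entropy_functional_le]). For the limit measure such a majorant is obtained
    by regularizing the lower limits of the localized entropies
    ([entropy_functional_limf_einf]). The same characterization makes the
    entropy convex in [gamma] without comparing Lebesgue decompositions
    ([entropy_functional_convex]).

    The set of minimizers is the lowest sublevel set, so every ultrafilter on
    it converges in it, which is compactness; existence comes from an
    ultrafilter refining all sublevel sets above the infimum. *)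

(** * Lower limits along a filter *)

Lemma lte_add_split (R : realType) (x y : \bar R) (r : R) : r%:E < x + y ->
  exists a b : R, [/\ a%:E < x, b%:E < y & r = (a + b)%R].
Proof.
case: x => [x| |]; case: y => [y| |]//=.
- rewrite -EFinD lte_fin => rxy.
  exists (x - (x + y - r) / 2)%R, (y - (x + y - r) / 2)%R.
  by split; rewrite ?lte_fin; lra.
- move=> _; exists (x - 1)%R, (r - (x - 1))%R.
  by split; rewrite ?ltry ?lte_fin//; lra.
- move=> _; exists (r - (y - 1))%R, (y - 1)%R.
  by split; rewrite ?ltry ?lte_fin//; lra.
- by move=> _; exists r, 0%R; split; rewrite ?ltry//; lra.
Qed.

Lemma lee_from_real (R : realType) (x y : \bar R) :
  (forall r : R, r%:E < x -> r%:E <= y) -> x <= y.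
Proof.
case: x => [x| |] h; last by rewrite leNye.
- apply/lee_subgt0Pr => e e0; rewrite -EFinB; apply: h.
  by rewrite lte_fin; lra.
- rewrite leye_eq; case: y h => [y| |]// h.
    by have := h (y + 1)%R (ltry _); rewrite lee_fin; lra.
  by have := h 0%R (ltry _).
Qed.

(** The lower bounds exclude the sum of [-oo] and [+oo], which is [-oo]. *)
Lemma gte_add_split (R : realType) (x y : \bar R) (r : R) :
  -oo < x -> -oo < y -> x + y < r%:E ->
  exists a b : R, [/\ x < a%:E, y < b%:E & r = (a + b)%R].
Proof.
case: x => [x| |]; case: y => [y| |]//= _ _.
rewrite -EFinD lte_fin => rxy.
exists (x + (r - x - y) / 2)%R, (y + (r - x - y) / 2)%R.
by split; rewrite ?lte_fin; lra.
Qed.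

Lemma lee_to_real (R : realType) (x y : \bar R) :
  (forall r : R, y < r%:E -> x <= r%:E) -> x <= y.
Proof.
move=> h; rewrite -leeN2; apply: lee_from_real => r.
by rewrite lteNr -EFinN leeNr -EFinN; exact: h.
Qed.

Section lower_limit.
Context (T : choiceType) (I : filteredType T) (R : realType).
Implicit Types (f g : I -> \bar R) (U : set_system I).

Lemma limf_einf_ge U f x : U [set i | x <= f i] -> x <= limf_einf f U.
Proof.
move=> Ux; rewrite limf_einfE; apply: le_ereal_sup_tmp.
exists (ereal_inf (f @` [set i | x <= f i])).
  by exists [set i | x <= f i].
by apply: le_ereal_inf_tmp => _ [i fi <-].
Qed.

Lemma limf_einf_gt U f x : Filter U -> x < limf_einf f U ->
  U [set i | x < f i].
Proof.
move=> FU; rewrite limf_einfE => /ereal_sup_gt[_ [V UV <-] xV].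
apply: filterS UV => i Vi; apply: (lt_le_trans xV).
by apply: ereal_inf_lbound; exists i.
Qed.

Lemma le_limf_einf U f g : Filter U -> U [set i | f i <= g i] ->
  limf_einf f U <= limf_einf g U.
Proof.
move=> FU fg; rewrite [X in X <= _]limf_einfE.
apply: ge_ereal_sup => _ [V UV <-].
apply: limf_einf_ge; apply: filterS (filterI fg UV) => i [/= fgi Vi].
by apply: le_trans fgi; apply: ereal_inf_lbound; exists i.
Qed.

Lemma limf_einf_le U f x : ProperFilter U -> U [set i | f i <= x] ->
  limf_einf f U <= x.
Proof.
move=> FU Ux; rewrite leNgt; apply/negP => /limf_einf_gt xf.
have [i []] /= := filter_ex (filterI Ux xf).
by move=> /le_lt_trans/[apply]; rewrite ltxx.
Qed.

Lemma limf_einf_ge0 U f : Filter U -> (forall i, 0 <= f i) ->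
  0 <= limf_einf f U.
Proof. by move=> FU f0; apply: limf_einf_ge; apply: filterE. Qed.

Lemma limf_einfD U f g : Filter U ->
  limf_einf f U + limf_einf g U <= limf_einf (fun i => f i + g i) U.
Proof.
move=> FU; apply: lee_from_real => r /lte_add_split[a [b [af bg ->]]].
apply: limf_einf_ge.
apply: filterS (filterI (limf_einf_gt FU af) (limf_einf_gt FU bg)) =>
  i /= [fi gi].
by rewrite EFinD leeD// ltW.
Qed.

Lemma limf_einf_ultra_lt U f x : UltraFilter U -> limf_einf f U < x ->
  U [set i | f i < x].
Proof.
move=> UU fx; have [//|Uc] := in_ultra_setVsetC [set i | f i < x] UU.
have PU : ProperFilter U by exact: ultra_proper.
suff : x <= limf_einf f U by rewrite leNgt fx.
by apply: limf_einf_ge; apply: filterS Uc => i /= /negP; rewrite -leNgt.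
Qed.

(** An ultrafilter contains [f i < a] or its complement, so that along it a
    lower limit is a limit, hence additive; along a general filter only
    [limf_einfD] holds. *)
Lemma limf_einf_ultraD U f g : UltraFilter U ->
  (forall i, 0 <= f i) -> (forall i, 0 <= g i) ->
  limf_einf (fun i => f i + g i) U <= limf_einf f U + limf_einf g U.
Proof.
move=> UU f0 g0; have PU : ProperFilter U by exact: ultra_proper.
apply: lee_to_real => r /gte_add_split[].
- by rewrite (lt_le_trans ltNy0)// limf_einf_ge0.
- by rewrite (lt_le_trans ltNy0)// limf_einf_ge0.
move=> a [b [/(limf_einf_ultra_lt UU) Ua /(limf_einf_ultra_lt UU) Ub ->]].
apply: limf_einf_le; apply: filterS (filterI Ua Ub) => i [/= fi gi].
by rewrite EFinD leeD// ltW.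
Qed.

End lower_limit.

(** * Separation of compact sets *)

Section separation.
Context (X : topologicalType).
Implicit Types A B K : set X.

Definition separated_by_opens A B := exists U V : set X,
  [/\ open U, open V, A `<=` U, B `<=` V & U `&` V = set0].

Lemma separated_by_opens_sym A B :
  separated_by_opens A B -> separated_by_opens B A.
Proof. by move=> [U [V [? ? ? ? UV]]]; exists V, U; rewrite setIC; split. Qed.

(** Finitely many of the neighbourhoods of [B] provided by the points of [K]
    suffice, and their intersection serves all points of [K] at once. Applied
    first with [B] a point and then with [B] compact. *)
Lemma compact_separated K B : compact K ->
  (forall x, K x -> separated_by_opens [set x] B) -> separated_by_opens K B.
Proof.
move=> /compact_near_coveringP cK sep.
(* [P] passes to smaller [V]: near-covering along the small neighbourhoods [V]
   of [B] thus yields one [V] that is good for the whole of [K]. *)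
pose P (V : set X) x := exists2 U, open U /\ U x & U `&` V = set0.
have [->|/set0P/set_nbhs_pfilter BF] := eqVneq B set0.
  exists setT, set0; rewrite setI0; split => //; [exact: openT|exact: open0].
have FP : Filter (powerset_filter_from (set_nbhs B)).
  by case: (powerset_filter_from_filter BF).
have [|M [MF ME [V MV]]] := cK _ (powerset_filter_from (set_nbhs B)) P FP.
  move=> x /sep[U [V [oU oV xU BV UV]]].
  exists (U, [set W | set_nbhs B W /\ W `<=` V]) => /=.
    split; first by apply: open_nbhs_nbhs; split => //; apply: xU.
    by apply: powerset_filter_fromP; apply/set_nbhsP; exists V; split.
  move=> [y W] /= [Uy [BW WV]]; exists U => //.
  by apply/seteqP; split=> // z [Uz /WV Vz]; rewrite -UV.
move=> /(_ _ MV) KV; have /set_nbhsP[W [oW BW WV]] := MF _ MV.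
exists (\bigcup_(U in [set U | open U /\ U `&` V = set0]) U), W; split => //.
- by apply: bigcup_open => U [].
- by move=> x /KV[U [oU Ux] UV]; exists U.
- apply/seteqP; split => // z [[U [oU UV] Uz] /WV Vz].
  by rewrite -UV.
Qed.

Hypothesis hX : hausdorff_space X.

Lemma compact_disjoint_separated K L : compact K -> compact L ->
  K `&` L = set0 -> separated_by_opens K L.
Proof.
move=> cK cL KL; apply: compact_separated => // x Kx.
apply: separated_by_opens_sym; apply: compact_separated => // y Ly.
have : y != x.
  apply/eqP => yx; suff : (K `&` L) x by rewrite KL.
  by split => //; rewrite -yx.
have := hX; rewrite open_hausdorff => /[apply] -[[U V]] /= [yU xV].
move=> [oU oV /eqP UV].
exists U, V; split => //.
- by move=> _ ->; exact: set_mem.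
- by move=> _ ->; exact: set_mem.
Qed.

Lemma compact_setD_open K G : compact K -> open G -> compact (K `\` G).
Proof.
move=> cK oG; apply: (subclosed_compact _ cK); last exact: subDsetl.
by apply: closedI; [exact: compact_closed|exact: open_closedC].
Qed.

(** The parts of [K] outside [G1] and outside [G2] are disjoint, hence have
    disjoint neighbourhoods; removing those from [K] leaves the two pieces. *)
Lemma compact_split K G1 G2 : compact K -> open G1 -> open G2 ->
  K `<=` G1 `|` G2 -> exists K1 K2, [/\ compact K1, compact K2, K1 `<=` G1,
    K2 `<=` G2 & K = K1 `|` K2].
Proof.
move=> cK o1 o2 K12.
have [] := @compact_disjoint_separated (K `\` G1) (K `\` G2).
- exact: compact_setD_open.
- exact: compact_setD_open.
- by apply/seteqP; split => // x [[Kx n1] [_ n2]]; case: (K12 _ Kx).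
move=> U [V [oU oV KU KV UV]]; exists (K `\` U), (K `\` V); split.
- exact: compact_setD_open.
- exact: compact_setD_open.
- by move=> x [Kx Ux]; apply: contrapT => G1x; apply: Ux; apply: KU.
- by move=> x [Kx Vx]; apply: contrapT => G2x; apply: Vx; apply: KV.
- apply/seteqP; split => [x Kx|x [[]|[]]//].
  have [Ux|Ux] := pselect (U x); last by left.
  by right; split => // Vx; have : (U `&` V) x by []; rewrite UV.
Qed.

End separation.

Lemma compact_borel (X : ptopologicalType) (K : set X) :
  hausdorff_space X -> compact K -> measurable (K : set (borel X)).
Proof.
move=> hX cK; rewrite -[K]setCK; apply: measurableC.
by apply: open_borel_measurable; apply: closed_openC; exact: compact_closed.
Qed.

Lemma hausdorff_prod (X Y : topologicalType) :
  hausdorff_space X -> hausdorff_space Y -> hausdorff_space (X * Y)%type.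
Proof.
rewrite !open_hausdorff => hX hY [x1 y1] [x2 y2]; rewrite xpair_eqE negb_and.
case/orP => [/hX|/hY] [[U V]] /= [/set_mem xU /set_mem xV] [oU oV /eqP UV].
- exists (fst @^-1` U, fst @^-1` V) => /=; first by split; apply: mem_set.
  split.
  + by apply: open_comp => // ? _; exact: cvg_fst.
  + by apply: open_comp => // ? _; exact: cvg_fst.
  + by rewrite -preimage_setI UV preimage_set0.
- exists (snd @^-1` U, snd @^-1` V) => /=; first by split; apply: mem_set.
  split.
  + by apply: open_comp => // ? _; exact: cvg_snd.
  + by apply: open_comp => // ? _; exact: cvg_snd.
  + by rewrite -preimage_setI UV preimage_set0.
Qed.

(** * Radon measures from contents on compact sets *)

Section contents.
Context (R : realType) (X : ptopologicalType).
Implicit Types (A B G K L : set X) (lam : set X -> \bar R).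

(** For suitable [lam], the restriction of [open_hull lam] to compact sets is a
    content, and [open_hull (inner_content lam)] is the outer measure of the
    Radon measure that this content generates. *)
Definition open_hull lam A :=
  ereal_inf [set lam G | G in [set G | open G /\ A `<=` G]].

Definition inner_content lam A :=
  ereal_sup [set open_hull lam K | K in [set K | compact K /\ K `<=` A]].

Lemma open_hull_le lam A G : open G -> A `<=` G -> open_hull lam A <= lam G.
Proof. by move=> oG AG; apply: ereal_inf_lbound; exists G. Qed.

Lemma open_hull_ge lam A x :
  (forall G, open G -> A `<=` G -> x <= lam G) -> x <= open_hull lam A.
Proof. by move=> h; apply: le_ereal_inf_tmp => _ [G [oG AG] <-]; exact: h. Qed.

Lemma open_hull_lt lam A x : open_hull lam A < x ->
  exists G, [/\ open G, A `<=` G & lam G < x].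
Proof. by move=> /ereal_inf_lt[_ [G [oG AG] <-]] ?; exists G. Qed.

Lemma inner_content_ge lam K A : compact K -> K `<=` A ->
  open_hull lam K <= inner_content lam A.
Proof. by move=> cK KA; apply: ereal_sup_ubound; exists K. Qed.

Lemma inner_content_le lam A x :
  (forall K, compact K -> K `<=` A -> open_hull lam K <= x) ->
  inner_content lam A <= x.
Proof. by move=> h; apply: ge_ereal_sup => _ [K [cK KA] <-]; exact: h. Qed.

Lemma inner_content_gt lam A x : x < inner_content lam A ->
  exists K, [/\ compact K, K `<=` A & x < open_hull lam K].
Proof. by move=> /ereal_sup_gt[_ [K [cK KA] <-]] ?; exists K. Qed.

Lemma subset_open_hull lam A B : A `<=` B -> open_hull lam A <= open_hull lam B.
Proof.
move=> AB; apply: open_hull_ge => G oG BG; apply: open_hull_le => //.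
exact: subset_trans BG.
Qed.

Lemma subset_inner_content lam A B : A `<=` B ->
  inner_content lam A <= inner_content lam B.
Proof.
move=> AB; apply: inner_content_le => K cK KA; apply: inner_content_ge => //.
exact: subset_trans AB.
Qed.

Lemma inner_content_le_open lam G : open G -> inner_content lam G <= lam G.
Proof. by move=> oG; apply: inner_content_le => K cK; exact: open_hull_le. Qed.

Section superadditive.
Variable lam : set X -> \bar R.
Hypothesis hX : hausdorff_space X.
Hypothesis lam_ge0 : forall A, 0 <= lam A.
Hypothesis lam_mono : forall G H, open G -> open H -> G `<=` H ->
  lam G <= lam H.
Hypothesis lam_superadd : forall G H, open G -> open H -> G `&` H = set0 ->
  lam G + lam H <= lam (G `|` H).

Lemma open_hull_ge0 A : 0 <= open_hull lam A.
Proof. exact: open_hull_ge. Qed.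

Lemma inner_content_ge0 A : 0 <= inner_content lam A.
Proof.
apply: (le_trans (open_hull_ge0 set0)); apply: inner_content_ge => //.
exact: compact0.
Qed.

(** Disjoint compact sets have disjoint open neighbourhoods, on which [lam] is
    superadditive. *)
Lemma open_hull_superadd K L : compact K -> compact L -> K `&` L = set0 ->
  open_hull lam K + open_hull lam L <= open_hull lam (K `|` L).
Proof.
move=> cK cL KL; apply: open_hull_ge => G oG KLG.
have [U [V [oU oV KU LV UV]]] := compact_disjoint_separated hX cK cL KL.
have oGU : open (G `&` U) by exact: openI.
have oGV : open (G `&` V) by exact: openI.
apply: (@le_trans _ _ (lam (G `&` U) + lam (G `&` V))).
  apply: leeD; apply: open_hull_le => //.
  - by move=> x Kx; split; [apply: KLG; left|exact: KU].
  - by move=> x Lx; split; [apply: KLG; right|exact: LV].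
apply: (le_trans (lam_superadd oGU oGV _)).
  by rewrite setIACA UV setI0.
apply: lam_mono => //; first exact: openU.
by move=> x [[]|[]].
Qed.

Lemma inner_content_superadd A B : A `&` B = set0 ->
  inner_content lam A + inner_content lam B <= inner_content lam (A `|` B).
Proof.
move=> AB; apply: lee_from_real => r.
case/lte_add_split => a [b [+ + ->]].
move=> /inner_content_gt[K [cK KA aK]] /inner_content_gt[L [cL LB bL]].
rewrite EFinD (le_trans (leeD (ltW aK) (ltW bL)))//.
apply: (le_trans (open_hull_superadd cK cL _)).
  by apply: subsetI_eq0 AB.
apply: inner_content_ge; first exact: compactU.
exact: setUSS.
Qed.

Section subadditive.
Hypothesis lam0 : lam set0 = 0.
Hypothesis lamT : lam setT < +oo.
Hypothesis lam_subadd : forall G H, open G -> open H ->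
  lam (G `|` H) <= lam G + lam H.

Let gtNy A : -oo < open_hull lam A.
Proof. by rewrite (lt_le_trans ltNy0)// open_hull_ge0. Qed.

Lemma open_hull_subadd A B :
  open_hull lam (A `|` B) <= open_hull lam A + open_hull lam B.
Proof.
apply: lee_to_real => r /gte_add_split[]// a [b [+ + ->]].
move=> /open_hull_lt[G [oG AG Ga]] /open_hull_lt[H [oH BH Hb]].
apply: (@le_trans _ _ (lam (G `|` H))).
  by apply: open_hull_le; [exact: openU|exact: setUSS].
by rewrite EFinD (le_trans (lam_subadd oG oH))// leeD// ltW.
Qed.

(** [compact_split] distributes [K] over the open sets that cover it. *)
Lemma open_hull_compact_le_sum (G : nat -> set X) n K :
  (forall i, open (G i)) -> compact K -> K `<=` \big[setU/set0]_(i < n) G i ->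
  open_hull lam K <= \sum_(i < n) inner_content lam (G i).
Proof.
move=> oG; elim: n K => [|n IHn] K cK.
  by rewrite !big_ord0 -lam0; apply: open_hull_le; exact: open0.
rewrite !big_ord_recr/= => KG.
have [|K1 [K2 [cK1 cK2 KG1 KG2 ->]]] := compact_split hX cK _ (oG n) KG.
  by elim/big_ind : _ => //; [exact: open0|exact: openU].
apply: (le_trans (open_hull_subadd _ _)).
by apply: leeD; [exact: IHn|exact: inner_content_ge].
Qed.

Lemma inner_content_bigcup (G : nat -> set X) : (forall i, open (G i)) ->
  inner_content lam (\bigcup_n G n) <= \sum_(n <oo) inner_content lam (G n).
Proof.
move=> oG; apply: inner_content_le => K cK KG.
have := cK; rewrite compact_near_coveringP.
move=> /(_ nat \oo (fun n x => (\big[setU/set0]_(i < n) G i) x) _)[].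
  move=> x /KG[n _ Gnx]; exists (G n, [set m | (n < m)%N]) => /=.
    by split; [exact: open_nbhs_nbhs|exists n.+1].
  move=> [y m] /= [Gny nm]; rewrite -bigcup_mkord; by exists n.
move=> N _ /(_ N (leqnn N)) KN.
apply: (le_trans (open_hull_compact_le_sum oG cK KN)).
rewrite -(big_mkord xpredT (fun i => inner_content lam (G i))).
by apply: nneseries_lim_ge => i _ _; exact: inner_content_ge0.
Qed.

Let M := open_hull (inner_content lam).

Let inner_fin A : inner_content lam A \is a fin_num.
Proof.
rewrite ge0_fin_numE ?inner_content_ge0//.
apply: le_lt_trans lamT; apply: (@le_trans _ _ (inner_content lam setT)).
  exact: subset_inner_content.
by apply: inner_content_le_open; exact: openT.
Qed.

Let M_open G : open G -> M G = inner_content lam G.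
Proof.
move=> oG; apply/eqP; rewrite eq_le; apply/andP; split.
  exact: open_hull_le.
by apply: open_hull_ge => H oH; exact: subset_inner_content.
Qed.

Let M_ge0 A : 0 <= M A.
Proof. by apply: open_hull_ge => G _ _; exact: inner_content_ge0. Qed.

Let M_fin A : M A \is a fin_num.
Proof.
rewrite ge0_fin_numE//; apply: (@le_lt_trans _ _ (inner_content lam setT)).
  by apply: open_hull_le => //; exact: openT.
by rewrite -ge0_fin_numE// inner_content_ge0.
Qed.

Let M0 : M set0 = 0.
Proof.
rewrite M_open; last exact: open0.
apply/eqP; rewrite eq_le inner_content_ge0 andbT.
apply: inner_content_le => K _ K0; rewrite -lam0.
by apply: open_hull_le => //; exact: open0.
Qed.

Let M_sigma_subadd : sigma_subadditive M.
Proof.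
move=> A; apply/lee_addgt0Pr => e e0.
have h n : exists G, [/\ open G, A n `<=` G &
    inner_content lam G < M (A n) + (e / (2 ^ n.+1)%:R)%:E].
  apply: open_hull_lt; rewrite -/M lteDl// lte_fin.
  by rewrite divr_gt0// ltr0n expn_gt0.
pose G n := sval (cid (h n)).
have oG n : open (G n) by rewrite /G; case: cid => ? [].
have AG n : A n `<=` G n by rewrite /G; case: cid => ? [].
have GM n : inner_content lam (G n) <= M (A n) + (e / (2 ^ n.+1)%:R)%:E.
  by apply: ltW; rewrite /G; case: cid => ? [].
apply: (@le_trans _ _ (inner_content lam (\bigcup_n G n))).
  apply: open_hull_le; first exact: bigcup_open.
  by apply: subset_bigcup => i _; exact: AG.
apply: (le_trans (inner_content_bigcup oG)).
apply: le_trans (epsilon_trick _ _ _); [|by []|exact: ltW].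
apply: lee_nneseries => // i _ _; exact: inner_content_ge0.
Qed.

Let om : {outer_measure set X -> \bar R} :=
  HB.pack M (@isOuterMeasure.Build R X M M0 M_ge0 (@subset_open_hull _)
    M_sigma_subadd).

(** Let [H] be an open set containing [A]. A nearly optimal compact set [K]
    inside [H] and [G] leaves the open set [H] minus [K], which still contains
    the part of [A] outside [G]; superadditivity is applied to these two
    disjoint sets. *)
Lemma open_caratheodory G : open G -> M.-caratheodory G.
Proof.
move=> oG; apply: (@le_caratheodory_measurable _ _ om) => A /=.
apply: open_hull_ge => H oH AH.
apply: (@le_trans _ _ (M (H `&` G) + M (A `&` ~` G))).
  by rewrite leeD2r//; apply: subset_open_hull; exact: setSI.
rewrite M_open; last exact: openI.
rewrite -leeBrDr//; apply: inner_content_le => K cK KHG.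
rewrite leeBrDr//.
apply: (@le_trans _ _ (inner_content lam K + inner_content lam (H `\` K))).
  apply: leeD; first exact: inner_content_ge.
  apply: open_hull_le.
    by apply: openI => //; apply: closed_openC; exact: compact_closed.
  move=> x [Ax Gx]; split; first exact: AH.
  by move=> /KHG[].
apply: (le_trans (inner_content_superadd _)); first by rewrite setDIK.
apply: subset_inner_content => x [/KHG[]//|[]//].
Qed.

Lemma borel_caratheodory (A : set (borel X)) : measurable A ->
  M.-caratheodory A.
Proof.
move=> /(_ (@measurable _ (caratheodory_type om))); apply.
split; last by move=> G oG; exact: open_caratheodory.
split; first exact: measurable0.
- by move=> B mB; rewrite setTD; exact: measurableC.
- by move=> B mB; exact: bigcup_measurable.
Qed.

Let M_sigma_additive : semi_sigma_additive (M : set (borel X) -> \bar R).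
Proof.
move=> A mA tA mUA; apply: (@caratheodory_measure_sigma_additive _ _ om) => //.
- by move=> i; exact: borel_caratheodory.
- exact: borel_caratheodory.
Qed.

Let M_finite : fin_num_fun (M : set (borel X) -> \bar R).
Proof. by move=> A _; exact: M_fin. Qed.

Let m0 : {measure set (borel X) -> \bar R} :=
  HB.pack (M : set (borel X) -> \bar R) (@isMeasure.Build _ _ _
    (M : set (borel X) -> \bar R) M0 M_ge0 M_sigma_additive).

Let m : {finite_measure set (borel X) -> \bar R} :=
  HB.pack (m0 : set (borel X) -> \bar R)
   (Measure.on m0) (@Measure_isFinite.Build _ _ _ m0 M_finite).

(** A compact set [K0] carries all the mass up to [e / 2]. An open set [G] that
    contains the complement of [B] with excess at most [e / 2] leaves a closed
    set inside [B]; the intersection of the two is the compact set required. *)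
Lemma content_radon : is_radon m.
Proof.
move=> B e mB e0.
have e20 : (0 < e / 2)%R by rewrite divr_gt0.
have [K0 [cK0 K0e]] : exists K0, compact K0 /\ m (~` K0) <= (e / 2)%:E.
  have [|K [cK _ KT]] := @inner_content_gt lam setT (inner_content lam setT -
    (e / 2)%:E).
    by rewrite lteBlDr// lteDl.
  exists K; split => //.
  have mK := compact_borel hX cK.
  have mT : m setT = inner_content lam setT.
    by rewrite /m/= M_open//; exact: openT.
  have -> : m (~` K) = m setT - m K.
    by rewrite -setTD measureD ?setTI// -ge0_fin_numE// fin_num_measure.
  rewrite leeBlDr ?fin_num_measure// mT -leeBlDl//.
  apply: (le_trans (ltW KT)); apply: open_hull_ge => G oG KG.
  exact: inner_content_ge.
have [|G [oG BG Ge]] :=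
  @open_hull_lt (inner_content lam) (~` B) (M (~` B) + (e / 2)%:E).
  by rewrite -/M lteDl.
exists (K0 `\` G); split.
- exact: compact_setD_open.
- by move=> x [_ Gx]; apply: contrapT => Bx; apply: Gx; exact: BG.
have mG : measurable (G : set (borel X)) by exact: open_borel_measurable.
have mK0 := compact_borel hX cK0.
apply: (@le_trans _ _ (m ((G `&` B) `|` ~` K0))).
  apply: le_measure.
  - by apply: mem_set; exact: measurableD mB (measurableD mK0 mG).
  - by apply: mem_set; apply: measurableU;
    [exact: measurableI|exact: measurableC].
  move=> x [Bx Kx]; have [K0x|] := pselect (K0 x); last by right.
  by left; split => //; apply: contrapT => Gx; apply: Kx.
apply: (le_trans (measureU2 _ _ _)).
- exact: measurableI.
- exact: measurableC.
rewrite (splitr e) EFinD; apply: leeD => //.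
have mGB : m (G `&` B) = m G - m (~` B).
  rewrite -[B in LHS]setCK -setDE measureD//.
  - by congr (_ - m _); apply/setIidPr.
  - exact: measurableC.
  - by rewrite -ge0_fin_numE// fin_num_measure.
have mGE : m G = inner_content lam G by rewrite /m/= M_open.
apply: (@le_trans _ _ (m G - m (~` B))); first by rewrite -mGB.
rewrite leeBlDr ?fin_num_measure//; last exact: measurableC.
by rewrite mGE addeC; exact: ltW.
Qed.

Lemma radon_of_content : exists mu : radon_measure R X,
  forall G, open G -> mu G = inner_content lam G.
Proof. by exists (RadonMeasure content_radon). Qed.

End subadditive.
End superadditive.
End contents.

(** * Lower semicontinuity of integrals and narrow convergence *)

Section layers.
Context (R : realType) (T : Type).
Variables (f : T -> \bar R) (delta : R).
Hypotheses (f_ge0 : forall x, 0 <= f x) (delta_gt0 : (0 < delta)%R).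

Definition layer k : set T := [set x | (k.+1%:R * delta)%:E < f x].

(** The layer-cake sum of height [n delta] with step [delta]. For [f] lower
    semicontinuous it combines indicators of open sets with positive weights,
    so that lower bounds on the masses of open sets apply to its integral. *)
Definition layers n x : \bar R := \sum_(k < n) delta%:E * (\1_(layer k) x)%:E.

Lemma layersS n x : layers n.+1 x =
  layers n x + (if (n.+1%:R * delta)%:E < f x then delta%:E else 0).
Proof.
rewrite /layers big_ord_recr/= indicE; congr (_ + _).
case: ifPn => [xf|xf].
  by rewrite mem_set// mule1.
by rewrite memNset ?mule0//; exact/negP.
Qed.

Lemma layers_ge0 n x : 0 <= layers n x.
Proof. by apply: sume_ge0 => k _; rewrite mule_ge0// lee_fin// ltW. Qed.

Lemma layers_le n x : layers n x <= f x /\ layers n x <= (n%:R * delta)%:E.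
Proof.
elim: n => [|n [IH1 IH2]]; first by rewrite /layers big_ord0 mul0r.
rewrite layersS; case: ifPn => [xf|_].
  suff h : layers n x + delta%:E <= (n.+1%:R * delta)%:E.
    by split => //; apply: (le_trans h); exact: ltW.
  by rewrite -natr1 mulrDl mul1r EFinD leeD2r.
rewrite adde0; split => //; apply: (le_trans IH2).
by rewrite lee_fin ler_pM2r// ler_nat.
Qed.

Lemma layers_approx n x :
  f x <= layers n x + delta%:E \/ layers n x = (n%:R * delta)%:E.
Proof.
elim: n => [|n IH]; first by right; rewrite /layers big_ord0 mul0r.
rewrite layersS; case: ifPn => [xf|]; last rewrite -leNgt adde0 => xf.
  right; case: IH => [h|->]; last by rewrite -EFinD -natr1 mulrDl mul1r.
  exfalso; have [_] := layers_le n x; move/(leeD2r delta%:E).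
  move=> /(le_trans h)/(lt_le_trans xf).
  by rewrite -EFinD lte_fin -natr1 mulrDl mul1r ltxx.
case: IH => [h|h]; first by left.
by left; rewrite h -EFinD; move: xf; rewrite -natr1 mulrDl mul1r.
Qed.

Lemma layers_nondecreasing x :
  {homo (layers ^~ x) : n m / (n <= m)%N >-> n <= m}.
Proof.
apply/nondecreasing_seqP => n; rewrite layersS leeDl//.
by case: ifP => _ //; rewrite lee_fin ltW.
Qed.

Lemma le_ereal_sup_layers x :
  f x <= ereal_sup (range (fun n => layers n x + delta%:E)).
Proof.
have [[n fn]|/forallNP h] := pselect (exists n, f x <= layers n x + delta%:E).
  by apply: (le_trans fn); apply: ereal_sup_ubound; exists n.
apply: lee_from_real => r _.
apply: le_ereal_sup_tmp.
pose n := (Num.truncn `|r / delta|%R).+1.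
exists (layers n x + delta%:E); first by exists n.
have [/h//|->] := layers_approx n x.
rewrite -EFinD lee_fin.
have : (r / delta <= n%:R)%R.
  by apply: (le_trans (ler_norm _)); apply: ltW; exact: truncnS_gt.
by rewrite ler_pdivrMr// => /le_trans; apply; rewrite lerDl ltW.
Qed.

End layers.

Lemma measurable_lsc (R : realType) (X : ptopologicalType) (f : X -> \bar R) :
  lower_semicontinuous f -> measurable_fun [set: borel X] (f : borel X ->
    \bar R).
Proof.
move=> lf; apply: (measurability _ (ErealGenOInfty.measurableE R)).
move=> /= _ [_ [a ->]] <-; rewrite setTI preimage_itvoy.
by apply: open_borel_measurable; move/lower_semicontinuousP : lf; exact.
Qed.

Section narrow.
Context (R : realType) (X : ptopologicalType).
Notation M := (radon_measure R X).
Context (T : choiceType) (I : filteredType T).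
Implicit Types (U : set_system I) (f : X -> \bar R).
Implicit Types (nu : I -> {finite_measure set (borel X) -> \bar R}).
Implicit Types (g : {finite_measure set (borel X) -> \bar R}).

Lemma integral_layers (m : {measure set (borel X) -> \bar R}) f (delta : R) n :
  (0 < delta)%R -> lower_semicontinuous f ->
  \int[m]_(x in [set: borel X]) layers f delta n x =
  \sum_(k < n) delta%:E * m (layer f delta k).
Proof.
move=> d0 lf.
have mlayer k : measurable (layer f delta k : set (borel X)).
  by apply: open_borel_measurable; move/lower_semicontinuousP : lf; exact.
have mi k : measurable_fun [set: borel X] (fun x =>
  (\1_(layer f delta k) x)%:E : \bar R).
  by apply/measurable_EFinP; exact: measurable_indic.
rewrite /layers ge0_integral_sum//=.
- apply: eq_bigr => k _; rewrite ge0_integralZl ?lee_fin ?ltW//.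
  by rewrite integral_indic// setIT.
- by move=> k; exact: measurable_funeM.
- by move=> k x _; rewrite mule_ge0// lee_fin// ltW.
Qed.

Lemma measurable_layers f (delta : R) n : lower_semicontinuous f ->
  measurable_fun [set: borel X] (layers f delta n).
Proof.
move=> lf; apply: emeasurable_sum => k; apply: measurable_funeM.
apply/measurable_EFinP; apply: measurable_indic.
by apply: open_borel_measurable; move/lower_semicontinuousP : lf; exact.
Qed.

(** Narrow convergence in terms of masses of open sets. Unlike the narrow
    topology, this makes sense for any family of finite measures, in particular
    for the marginals of a family of Radon measures. *)
Definition portmanteau_limit U nu g :=
  (forall G : set X, open G -> g G <= limf_einf (fun i => nu i G) U) /\
  (forall e : R, (0 < e)%R -> U [set i | nu i setT <= g setT + e%:E]).

Lemma limf_einf_sum U (F : nat -> I -> \bar R) n : Filter U ->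
  \sum_(k < n) limf_einf (F k) U <= limf_einf (fun mu => \sum_(k < n) F k mu) U.
Proof.
move=> FU; elim: n => [|n IHn].
  rewrite big_ord0; apply: limf_einf_ge.
  by apply: filterE => mu /=; rewrite big_ord0.
rewrite big_ord_recr/=; apply: (le_trans (leeD2r _ IHn)).
apply: (le_trans (limf_einfD _ _ FU)).
by apply: le_limf_einf; apply: filterE => mu /=; rewrite big_ord_recr.
Qed.

Lemma limf_einfZ U (F : I -> \bar R) (r : R) : Filter U -> (0 < r)%R ->
  r%:E * limf_einf F U <= limf_einf (fun mu => r%:E * F mu) U.
Proof.
move=> FU r0; apply: lee_from_real => y.
rewrite muleC -lte_pdivrMr// => /(limf_einf_gt FU) UF.
apply: limf_einf_ge; apply: filterS UF => mu /=.
by rewrite lte_pdivrMr// muleC => /ltW.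
Qed.

Lemma integral_lsc_limf_einf U nu g f :
  ProperFilter U -> portmanteau_limit U nu g ->
  (forall x, 0 <= f x) -> lower_semicontinuous f ->
  \int[g]_(x in [set: borel X]) f x <=
  limf_einf (fun i => \int[nu i]_(x in [set: borel X]) f x) U.
Proof.
move=> PU [Ug _] f0 lf.
set L := limf_einf _ _.
have h (d : R) : (0 < d)%R ->
    \int[g]_(x in [set: borel X]) f x <= L + d%:E * g setT.
  move=> d0.
  have cv x : (fun n => layers f d n x + d%:E) @ \oo -->
      ereal_sup (range (fun n => layers f d n x + d%:E)).
    apply: ereal_nondecreasing_cvgn => n m nm.
    by rewrite leeD2r// layers_nondecreasing.
  have mf n : measurable_fun [set: borel X] (fun x => layers f d n x + d%:E).
    by apply: emeasurable_funD => //; exact: measurable_layers.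
  have f0' n x : 0 <= layers f d n x + d%:E.
    by rewrite adde_ge0 ?layers_ge0// lee_fin ltW.
  have mlim : measurable_fun [set: borel X]
      (fun x => limn (fun n => layers f d n x + d%:E)).
    by apply: (emeasurable_fun_cvg _ _ mf) => x _; rewrite (cvg_lim _ (cv x)).
  apply: (@le_trans _ _ (\int[g]_(x in [set: borel X])
      limn (fun n => layers f d n x + d%:E))).
    apply: ge0_le_integral => //; first exact: measurable_lsc.
    by move=> x _; rewrite (cvg_lim _ (cv x))//; exact: le_ereal_sup_layers.
  rewrite monotone_convergence//; last first.
    by move=> x _ n m nm; rewrite leeD2r// layers_nondecreasing.
  apply: lime_le.
    apply: ereal_nondecreasing_is_cvgn => n m nm;
      apply: ge0_le_integral => // x _.
    by rewrite leeD2r// layers_nondecreasing.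
  apply: nearW => n.
  rewrite ge0_integralD//; last 3 first.
  - by move=> x _; exact: layers_ge0.
  - exact: measurable_layers.
  - by move=> x _; rewrite lee_fin ltW.
  rewrite integral_cst// leeD2r// integral_layers//.
  apply: (@le_trans _ _ (\sum_(k < n) limf_einf (fun i =>
    d%:E * nu i (layer f d k)) U)).
    apply: lee_sum => k _; apply: le_trans (limf_einfZ _ _ _) => //.
    apply: lee_wpmul2l; first by rewrite lee_fin ltW.
    apply: Ug.
    by move/lower_semicontinuousP : lf; exact.
  apply: (le_trans (limf_einf_sum (fun k i => d%:E * nu i (layer f d k)) n PU)).
  apply: le_limf_einf; apply: filterE => mu /=.
  rewrite -integral_layers//; apply: ge0_le_integral => //.
  - by move=> x _; exact: layers_ge0.
  - exact: measurable_layers.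
  - exact: measurable_lsc.
  - by move=> x _; have [] := layers_le f0 d0 n x.
apply/lee_addgt0Pr => e e0.
pose d := (e / (1 + fine (g setT)))%R.
have gT : (0 <= fine (g setT))%R by exact: fine_ge0.
apply: (le_trans (h d _)); first by rewrite divr_gt0//; lra.
rewrite leeD2l// -(fineK (fin_num_measure g _ measurableT)) -EFinM lee_fin.
rewrite /d -mulrA; apply: ler_piMr; first exact: ltW.
by rewrite mulrC ler_pdivrMr; lra.
Qed.

End narrow.

(** A bounded integrand becomes nonnegative after adding a constant [C]; this
    shifts its integral by [C] times the mass, which is controlled from above
    along [U]. *)
Lemma portmanteau_cvg (R : realType) (X : ptopologicalType)
    (U : set_system (radon_measure R X)) (g : radon_measure R X) :
  ProperFilter U -> portmanteau_limit U (@radon_fmeas R X) g -> U --> g.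
Proof.
pose M := radon_measure R X.
move=> PU Ug.
have key (phi : X -> R) (a : R) : (exists C : R, forall x, (`|phi x| <= C)%R) ->
    lower_semicontinuous (EFin \o phi) ->
    a%:E < \int[g]_(x in [set: borel X]) (phi x)%:E ->
    U [set mu : M | a%:E < \int[mu]_(x in [set: borel X]) (phi x)%:E].
  move=> [C0 phiC0] lphi ag.
  pose C := (`|C0| + 1)%R.
  have C_gt0 : (0 < C)%R by rewrite ltr_wpDl.
  have phiC x : (`|phi x| <= C)%R.
    by rewrite (le_trans (phiC0 x))// (le_trans (ler_norm _))// lerDl.
  have mphi : measurable_fun [set: borel X] (fun x => (phi x)%:E : \bar R).
    exact: (measurable_lsc lphi).
  have iphi (m : M) : m.-integrable [set: borel X] (EFin \o phi).
    apply: (@le_integrable _ _ _ _ _ _ _ (EFin \o cst C)) => //.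
      by move=> x _ /=; rewrite lee_fin (le_trans (phiC x))// ler_norm.
    exact: finite_measure_integrable_cst.
  pose psi x := (phi x)%:E + C%:E.
  have psi0 x : 0 <= psi x.
    by rewrite /psi -EFinD lee_fin; have := phiC x; rewrite ler_norml; lra.
  have lpsi : lower_semicontinuous psi.
    apply/lower_semicontinuousP => b.
    have := lphi; move/lower_semicontinuousP => /(_ (b - C)%R).
    congr open; apply/seteqP; split => x /=; rewrite /psi -EFinD !lte_fin; lra.
  have intpsi (m : M) : \int[m]_(x in [set: borel X]) psi x =
      \int[m]_(x in [set: borel X]) (phi x)%:E + C%:E * m setT.
    rewrite /psi integralD//.
    - by rewrite integral_cst.
    - exact: iphi.
    - exact: finite_measure_integrable_cst.
  have fphi (m : M) : \int[m]_(x in [set: borel X]) (phi x)%:E \is a fin_num.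
    by apply: integrable_fin_num => //; exact: iphi.
  have := integral_lsc_limf_einf PU Ug psi0 lpsi; rewrite intpsi.
  have fg : g setT \is a fin_num by exact: fin_num_measure.
  pose e := ((fine (\int[g]_(x in [set: borel X]) (phi x)%:E) - a) / (2 * C))%R.
  have ag' : (a < fine (\int[g]_(x in [set: borel X]) (phi x)%:E))%R.
    by rewrite -lte_fin fineK.
  have e0 : (0 < e)%R by rewrite /e divr_gt0//; [lra|rewrite mulr_gt0].
  have eC : (fine (\int[g]_(x in [set: borel X]) (phi x)%:E) = a + 2 * (e *
    C))%R.
    by rewrite /e; field; rewrite gt_eqF.
  rewrite -(fineK (fphi g)) -(fineK fg) -EFinM -EFinD => gL.
  have /limf_einf_gt Upsi : (a + e * C + C * fine (g setT))%:E <
      limf_einf (fun mu : M => \int[mu]_(x in [set: borel X]) psi x) U.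
    apply: lt_le_trans gL; rewrite lte_fin eC.
    have : (0 < e * C)%R by rewrite mulr_gt0. 
    lra.
  have [_ /(_ _ e0) Umass] := Ug.
  apply: filterS (filterI Upsi Umass) => mu [/=].
  have fmu : mu setT \is a fin_num by exact: fin_num_measure.
  rewrite intpsi -(fineK (fphi mu)) -(fineK fmu) -(fineK fg).
  rewrite -EFinM -!EFinD !lte_fin lee_fin => h1 h2.
  have : (C * fine (mu setT) <= C * (fine (g setT) + e))%R by rewrite ler_pM2l.
  lra.
move=> A; rewrite nbhsE => -[B [[D' sD' <-] [V D'V Vg]] BA].
apply: (filterS BA).
have [F FD FV] := sD' _ D'V.
apply: (@filterS _ _ _ V); first by move=> mu Vmu; exists V.
rewrite -FV.
apply: filter_bigI => i iF; have /set_mem[phi [a [phib lphi iE]]] := FD i iF.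
have {}Vg : V g by [].
move: Vg; rewrite -FV => /(_ i iF) /=; rewrite iE => ag.
exact: key.
Qed.

(** * Limits of tight ultrafilters *)

Section prokhorov.
Context (R : realType) (X : ptopologicalType).
Hypothesis hX : hausdorff_space X.
Notation M := (radon_measure R X).

(** The lower limits of masses of open sets along [U] are regularized into a
    Radon measure. Regularization can only lose mass, which gives the bound on
    open sets; tightness prevents the loss of total mass. *)
Lemma prokhorov_ultra (U : set_system M) : UltraFilter U ->
  (exists C : R, U [set mu : M | mu setT <= C%:E]) ->
  (forall e : R, (0 < e)%R ->
    exists2 K : set X, compact K & U [set mu : M | mu (~` K) <= e%:E]) ->
  exists g : M, portmanteau_limit U (@radon_fmeas R X) g.
Proof.
move=> UU [C UC] tight; have PU : ProperFilter U by exact: ultra_proper.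
pose lam (A : set X) := limf_einf (fun mu : M => mu A) U.
have lam_ge0 A : 0 <= lam A by exact: limf_einf_ge0.
have lam_mono G H : open G -> open H -> G `<=` H -> lam G <= lam H.
  move=> oG oH GH; apply: le_limf_einf; apply: filterE => mu /=.
  by apply: le_measure => //; apply: mem_set; exact: open_borel_measurable.
have lam_superadd G H : open G -> open H -> G `&` H = set0 ->
    lam G + lam H <= lam (G `|` H).
  move=> oG oH GH; apply: (le_trans (limf_einfD _ _ _)).
  apply: le_limf_einf; apply: filterE => mu /=.
  by rewrite measureU//; exact: open_borel_measurable.
have lam0 : lam set0 = 0.
  apply/eqP; rewrite eq_le lam_ge0 andbT; apply: limf_einf_le.
  by apply: filterE => mu /=; rewrite measure0.
have lamT : lam setT < +oo.
  by apply: (@le_lt_trans _ _ C%:E); [exact: limf_einf_le|rewrite ltry].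
have lam_subadd G H : open G -> open H -> lam (G `|` H) <= lam G + lam H.
  move=> oG oH; apply: le_trans (limf_einf_ultraD UU _ _) => //.
  apply: le_limf_einf; apply: filterE => mu /=.
  by apply: measureU2; exact: open_borel_measurable.
have [g gG] := radon_of_content hX lam_ge0 lam_mono lam_superadd
  lam0 lamT lam_subadd.
exists g; split; first by move=> G oG; rewrite gG//;
  exact: inner_content_le_open.
move=> e e0; have e20 : (0 < e / 2)%R by rewrite divr_gt0.
have [K cK UK] := tight _ e20.
suff h : lam setT <= g setT + (e / 2)%:E.
  have : lam setT < g setT + e%:E.
    apply: (le_lt_trans h); have := fin_num_measure g _ measurableT.
    move=> /fineK <-; rewrite -!EFinD lte_fin; lra.
  by move=> /(limf_einf_ultra_lt UU); apply: filterS => mu /ltW.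
rewrite gG; last exact: openT.
rewrite -leeBlDr//; apply: le_trans (inner_content_ge _ cK _); last by [].
apply: open_hull_ge => G oG KG; rewrite leeBlDr//.
apply: (@le_trans _ _ (limf_einf (fun mu : M => mu G + (e / 2)%:E) U)).
  apply: le_limf_einf; apply: filterS UK => mu /= mK.
  have mG : measurable (G : set (borel X)) by exact: open_borel_measurable.
  have mKc : measurable (~` K : set (borel X)) by apply: measurableC;
    exact: compact_borel.
  apply: (@le_trans _ _ (mu (G `|` ~` K))).
    apply: le_measure; [exact: mem_set|by apply: mem_set; exact: measurableU|].
    by move=> x _; have [/KG|] := pselect (K x); [left|right].
  by apply: (le_trans (measureU2 _ _ _)) => //; rewrite leeD2l.
apply: (le_trans (limf_einf_ultraD UU _ _)) => //.
  by move=> _; rewrite lee_fin ltW.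
by rewrite leeD2l//; apply: limf_einf_le; apply: filterE => mu /=.
Qed.

End prokhorov.

Section continuous_image.
Context (R : realType) (X Y : ptopologicalType) (f : X -> Y).
Hypotheses (hX : hausdorff_space X) (hY : hausdorff_space Y) (cf : continuous
  f).

Lemma continuous_image_radon (mu : radon_measure R X) :
  is_radon (continuous_image mu cf).
Proof.
move=> B e mB e0.
have mf A : measurable (A : set (borel Y)) ->
  measurable (f @^-1` A : set (borel X)).
  by move=> mA; rewrite -[X in measurable X]setTI;
    exact: continuous_borel_measurable.
have [K [cK KB Ke]] := radon_measureP mu (mf _ mB) e0.
have cfK : compact (f @` K).
  by apply: continuous_compact => //; exact: continuous_subspaceT.
exists (f @` K); split => //; first by move=> _ [x Kx <-]; exact: KB.
apply: le_trans Ke; rewrite /continuous_image /pushforward.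
have mfK := compact_borel hY cfK; have mK := compact_borel hX cK.
apply: le_measure.
- by apply: mem_set; apply: mf; exact: measurableD mB mfK.
- by apply: mem_set; exact: measurableD (mf _ mB) mK.
- by move=> x [Bx nx]; split => // Kx; apply: nx; exists x.
Qed.

Lemma continuous_image_portmanteau (T : choiceType) (I : filteredType T)
    (U : set_system I) (nu : I -> {finite_measure set (borel X) -> \bar R})
    (g : {finite_measure set (borel X) -> \bar R}) :
  portmanteau_limit U nu g ->
  portmanteau_limit U (fun i => continuous_image (nu i) cf)
    (continuous_image g cf).
Proof.
move=> [UG UT]; split => [G oG|e e0].
  by apply: UG; apply: open_comp => // x _; exact: cf.
exact: (UT _ e0).
Qed.

End continuous_image.

(** * Affine minorants of an entropy function *)

Section affine_minorants.
Context (R : realType) (F : R -> \bar R).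
Hypothesis hF : is_entropy_function F.

Definition affine_minorant (a b : R) :=
  forall s : R, (0 <= s)%R -> (a * s + b)%:E <= F s.

Lemma affine_minorant0 : affine_minorant 0 0.
Proof. by move=> s s0; rewrite mul0r add0r; exact: (entropy_ge0 hF). Qed.

Lemma entropy_gt_near (s0 t : R) : (0 <= s0)%R -> t%:E < F s0 ->
  exists2 d : R, (0 < d)%R &
    forall s, (0 <= s)%R -> (`|s - s0| < d)%R -> t%:E < F s.
Proof.
move=> s00 tF; have [V nV Vt] := entropy_lsc hF tF.
have As0 : `[0%R, +oo[%classic s0 by rewrite /= in_itv/= andbT.
have : within `[0%R, +oo[%classic (nbhs s0) V.
  by move: nV; rewrite nbhs_subspace_in.
rewrite /within/= => /nbhs_ballP[d d0 dV]; exists d => // s s_ge0 sd.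
apply: Vt; apply: dV => /=; first by rewrite /ball/= distrC.
by rewrite in_itv/= andbT.
Qed.

(** The slope is the supremum of the slopes of the chords that join the graph
    of [F], left of [s0], to the point [(s0, t)]. By convexity it is at most
    the slope of every chord on the right. Lower semicontinuity keeps the graph
    above [t] near [s0], which bounds the slopes on both sides. *)
Lemma affine_minorant_at (s0 t : R) : (0 <= s0)%R -> (0 <= t)%R ->
  t%:E < F s0 ->
  exists a : R, affine_minorant a (t - a * s0).
Proof.
move=> s00 t0 tF; have [d d0 dF] := entropy_gt_near s00 tF.
(* As [F >= 0], a chord that ends at distance at least [d] from [s0] has slope
   at most [M] on the left and at least [- M] on the right. The value [- M]
   stands in for the chords on the left when there are none. *)
pose M := (t / d)%R.
have M0 : (0 <= M)%R by rewrite divr_ge0// ltW.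
pose A : set R := [set q | q = (- M)%R \/ exists s y : R,
  [/\ (0 <= s < s0)%R, F s = y%:E & q = ((t - y) / (s0 - s))%R]].
have F0 s y : (0 <= s)%R -> F s = y%:E -> (0 <= y)%R.
  by move=> s_ge0 Fs; have := entropy_ge0 hF s_ge0; rewrite Fs.
have AM : ubound A M.
  move=> q [->|[s [y [/andP[s_ge0 ss0] Fs ->]]]]; first lra.
  rewrite ler_pdivrMr ?subr_gt0//.
  have [sd|sd] := ltP (`|s - s0|)%R d.
    have := dF _ s_ge0 sd; rewrite Fs lte_fin => ty.
    have : (0 <= M * (s0 - s))%R by apply: mulr_ge0 => //; lra.
    by lra.
  move: sd; rewrite ltr0_norm; last lra.
  move=> sd; have : (M * d <= M * (s0 - s))%R by apply: ler_wpM2l => //; lra.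
  by rewrite /M divfK ?gt_eqF//; have := F0 _ _ s_ge0 Fs; rewrite -/M; lra.
have AN : A (- M)%R by left.
have A0 : A !=set0 by exists (- M)%R.
have supA : has_sup A by split => //; exists M.
exists (sup A) => // s s_ge0.
have [ss0|ss0|->] := ltgtP s s0; last first.
- by rewrite addrC subrK; exact: ltW.
- case Fs : (F s) => [y| |]; last 2 first.
  + by rewrite leey.
  + by have := entropy_ge0 hF s_ge0; rewrite Fs.
  rewrite lee_fin.
  suff : (sup A <= (y - t) / (s - s0))%R.
    by rewrite ler_pdivlMr ?subr_gt0//; lra.
  apply: ge_sup => // q [->|[s1 [y1 [/andP[s1_ge0 s10] Fs1 ->]]]].
    rewrite ler_pdivlMr ?subr_gt0//.
    have [sd|sd] := ltP (`|s - s0|)%R d.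
      have := dF _ s_ge0 sd; rewrite Fs lte_fin => ty.
      have : (0 <= M * (s - s0))%R by apply: mulr_ge0 => //; lra.
      by lra.
    move: sd; rewrite gtr0_norm; last lra.
    move=> sd; have : (M * d <= M * (s - s0))%R by apply: ler_wpM2l => //; lra.
    by rewrite /M divfK ?gt_eqF//; have := F0 _ _ s_ge0 Fs; rewrite -/M; lra.
  rewrite ler_pdivrMr ?subr_gt0// mulrAC ler_pdivlMr ?subr_gt0//.
  pose l := ((s - s0) / (s - s1))%R.
  have ls : (l * (s - s1) = s - s0)%R by rewrite /l divfK// gt_eqF; lra.
  have l01 : (0 <= l <= 1)%R.
    rewrite /l ler_pdivlMr; last lra.
    by rewrite ler_pdivrMr; lra.
  have := entropy_convex hF l01 s1_ge0 s_ge0.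
  have -> : (l * s1 + (1 - l) * s = s0)%R by lra.
  rewrite Fs Fs1 -!EFinM -EFinD => /(lt_le_trans tF); rewrite lte_fin => tl.
  have : (t * (s - s1) <= (l * y1 + (1 - l) * y) * (s - s1))%R.
    by rewrite ler_wpM2r; lra.
  have -> : ((l * y1 + (1 - l) * y) * (s - s1) =
     (l * (s - s1)) * y1 + ((s - s1) - l * (s - s1)) * y)%R by ring.
  rewrite ls; lra.
- case Fs : (F s) => [y| |]; last 2 first.
  + by rewrite leey.
  + by have := entropy_ge0 hF s_ge0; rewrite Fs.
  rewrite lee_fin.
  have : ((t - y) / (s0 - s) <= sup A)%R.
    apply: ub_le_sup; first by exists M.
    by right; exists s, y; split => //; rewrite s_ge0.
  by rewrite ler_pdivrMr ?subr_gt0//; lra.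
Qed.

Lemma affine_minorant_approx (s0 t : R) : (0 <= s0)%R -> t%:E < F s0 ->
  exists a b : R, affine_minorant a b /\ (t < a * s0 + b)%R.
Proof.
move=> s00 tF; have [t0|t0] := ltP t 0%R.
  by exists 0%R, 0%R; split; [exact: affine_minorant0|lra].
have [t' tt' t'F] : exists2 t' : R, (t < t')%R & t'%:E < F s0.
  move: tF; case: (F s0) => [y| |]//.
    by rewrite lte_fin => ty; exists ((t + y) / 2)%R; rewrite ?lte_fin; lra.
  by move=> _; exists (t + 1)%R; rewrite ?ltry//; lra.
have [|a mina] := affine_minorant_at s00 _ t'F; first lra.
by exists a, (t' - a * s0)%R; split => //; lra.
Qed.

Definition slopes : set (\bar R) :=
  [set a%:E | a in [set a | exists b, affine_minorant a b]].

Let rec := ereal_sup slopes.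

Let rec_ge0 : 0 <= rec.
Proof.
by apply: ereal_sup_ubound; exists 0%R => //; exists 0%R;
  exact: affine_minorant0.
Qed.

Let slope_near (r : R) : r%:E < rec ->
  \forall s \near +oo%R, r%:E <= F s * (s^-1)%:E.
Proof.
move=> /ereal_sup_gt[_ [a [b ab] <-]]; rewrite lte_fin => ra.
near=> s.
have s0 : (0 < s)%R by near: s; apply: nbhs_pinfty_gt; rewrite num_real.
have bs : (`|b| / (a - r) <= s)%R by near: s; apply: nbhs_pinfty_ge;
  rewrite num_real.
apply: (@le_trans _ _ ((a * s + b)%:E * (s^-1)%:E)); last first.
  by apply: lee_wpmul2r; [rewrite lee_fin invr_ge0 ltW|exact: ab (ltW s0)].
rewrite -EFinM lee_fin ler_pdivlMr//.
move: bs; rewrite ler_pdivrMr ?subr_gt0// => bs.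
have := ler_norm (- b)%R; rewrite normrN; lra.
Unshelve. all: by end_near. Qed.

(** Let [F s1] be finite. To the right of [s1] each minorant lies below [F s1 +
    r (s - s1)], where [r] is the supremum of the slopes, hence so does [F];
    and [F] lies above each minorant. These bounds squeeze [F s / s] to [r], so
    that the limit that defines the recession constant exists. *)
Lemma recessionE : recession F = ereal_sup slopes.
Proof.
rewrite /recession; apply: cvg_lim; first exact: ereal_hausdorff.
rewrite -/rec; have [|rec_fin] := leP +oo rec.
  rewrite leye_eq => /eqP recy; rewrite recy; apply/cvgeyPge => A.
  by apply: slope_near; rewrite recy ltry.
have recE : rec = (fine rec)%:E by rewrite fineK// ge0_fin_numE.
have [s1 [s1_gt0 Fs1]] := entropy_proper hF.
have Fs1_ge0 := entropy_ge0 hF (ltW s1_gt0).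
set r := fine rec in recE; clearbody r.
have r0 : (0 <= r)%R by rewrite -lee_fin -recE.
have Fs1E : F s1 = (fine (F s1))%:E by rewrite fineK// ge0_fin_numE.
have upper s : (s1 <= s)%R -> F s <= (fine (F s1) + r * (s - s1))%:E.
  move=> s1s; have s_ge0 : (0 <= s)%R by lra.
  apply: lee_from_real => t /(affine_minorant_approx s_ge0)[a [b [ab tab]]].
  have ar : (a <= r)%R.
    by rewrite -lee_fin -recE; apply: ereal_sup_ubound; exists a => //;
      exists b.
  have := ab _ (ltW s1_gt0); rewrite Fs1E lee_fin => abs1.
  rewrite lee_fin.
  have : (a * (s - s1) <= r * (s - s1))%R by rewrite ler_wpM2r//; lra.
  by lra.
rewrite recE; apply/fine_cvgP; split.
  near=> s.
  have s0 : (0 < s)%R by near: s; apply: nbhs_pinfty_gt; rewrite num_real.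
  rewrite fin_numM// ge0_fin_numE ?(entropy_ge0 hF) ?ltW//.
  apply: (le_lt_trans (upper s _)); last exact: ltry.
  by near: s; apply: nbhs_pinfty_ge; rewrite num_real.
apply/cvgrPdist_le => e e0; near=> s; rewrite /=.
have s0 : (0 < s)%R by near: s; apply: nbhs_pinfty_gt; rewrite num_real.
have s1s : (s1 <= s)%R by near: s; apply: nbhs_pinfty_ge; rewrite num_real.
have Fse : (fine (F s1) / e <= s)%R by near: s; apply: nbhs_pinfty_ge;
  rewrite num_real.
have : (r - e)%:E <= F s * (s^-1)%:E.
  by near: s; apply: slope_near; rewrite recE lte_fin ltrBlDr ltrDl.
have Fs_fin : F s \is a fin_num.
  rewrite ge0_fin_numE ?(entropy_ge0 hF) ?ltW//.
  by apply: (le_lt_trans (upper s s1s)); exact: ltry.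
have := upper s s1s; rewrite -(fineK Fs_fin) -EFinM !lee_fin/= => up low.
rewrite ler_distlC; apply/andP; split; first lra.
rewrite ler_pdivrMr//; move: Fse; rewrite ler_pdivrMr//.
have : (0 <= r * s1)%R by rewrite mulr_ge0// ltW.
lra.
Unshelve. all: by end_near. Qed.

Lemma affine_minorant_slope_le a b : affine_minorant a b -> a%:E <= recession F.
Proof.
by move=> ab; rewrite recessionE; apply: ereal_sup_ubound; exists a => //;
  exists b.
Qed.

Lemma recession_ge0 : 0 <= recession F.
Proof. exact: affine_minorant_slope_le affine_minorant0. Qed.

Lemma affine_minorant_slope_gt (t : R) : t%:E < recession F ->
  exists a b : R, affine_minorant a b /\ (t < a)%R.
Proof.
rewrite recessionE => /ereal_sup_gt[_ [a [b ab] <-]]; rewrite lte_fin => ta.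
by exists a, b.
Qed.

(** Lowering both coefficients of a minorant gives a minorant on the half-line,
    so rational coefficients suffice, and these are countable. *)
Lemma affine_minorant_sequence : exists ab : nat -> R * R,
  [/\ forall n, affine_minorant (ab n).1 (ab n).2,
      forall s t : R, (0 <= s)%R -> t%:E < F s ->
        exists n, (t < (ab n).1 * s + (ab n).2)%R &
      forall t : R, t%:E < recession F -> exists n, (t < (ab n).1)%R].
Proof.
pose P (pq : rat * rat) := `[< affine_minorant (ratr pq.1) (ratr pq.2) >].
pose ab n : R * R := if @choice.unpickle (rat * rat)%type n is Some pq then
  if P pq then (ratr pq.1, ratr pq.2) else (0, 0)%R else (0, 0)%R.
have abP p q : affine_minorant (ratr p) (ratr q) -> exists n, ab n = (ratr p,
  ratr q).
  by move=> pq; exists (choice.pickle (p, q));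
    rewrite /ab choice.pickleK /P asboolT.
have lower a b p q : affine_minorant a b -> (p <= a)%R -> (q <= b)%R ->
  affine_minorant p q.
  move=> mab pa qb s s0; apply: le_trans (mab s s0); rewrite lee_fin lerD//.
  exact: ler_wpM2r.
exists ab; split.
- move=> n; rewrite /ab; case: choice.unpickle => [pq|];
  last exact: affine_minorant0.
  by case: ifPn => [/asboolP//|_]; exact: affine_minorant0.
- move=> s t s0 /(affine_minorant_approx s0)[a [b [mab tab]]].
  pose e := (a * s + b - t)%R; have e0 : (0 < e)%R by rewrite /e; lra.
  have ae : (a - e / (2 * (s + 1)) < a)%R
    by rewrite ltrBlDr ltrDl divr_gt0//; lra.
  have be : (b - e / 2 < b)%R by rewrite ltrBlDr ltrDl divr_gt0.
  have [p] := rat_in_itvoo ae; rewrite in_itv/= => /andP[pa1 pa2].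
  have [q] := rat_in_itvoo be; rewrite in_itv/= => /andP[qb1 qb2].
  have [n abn] := abP _ _ (lower _ _ _ _ mab (ltW pa2) (ltW qb2)).
  exists n; rewrite abn/=.
  have h1 : ((a - e / (2 * (s + 1))) * s <= ratr p * s)%R
    by rewrite ler_wpM2r// ltW.
  have h2 : (e / (2 * (s + 1)) * s <= e / 2)%R.
    by rewrite -mulrA ler_wpM2l ?(ltW e0)// mulrC ler_pdivrMr; lra.
  by move: h1; rewrite mulrBl /e in h2 *; rewrite /e in qb1; lra.
- move=> t /affine_minorant_slope_gt[a [b [mab ta]]].
  have b1 : (b - 1 < b)%R by lra.
  have [p] := rat_in_itvoo ta; rewrite in_itv/= => /andP[pa1 pa2].
  have [q] := rat_in_itvoo b1; rewrite in_itv/= => /andP[qb1 qb2].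
  have [n abn] := abP _ _ (lower _ _ _ _ mab (ltW pa2) (ltW qb2)).
  by exists n; rewrite abn.
Qed.

End affine_minorants.

(** * The entropy functional as a least superadditive majorant *)

(** Starting from 0, which is a minorant of every entropy function, makes all
    these maxima nonnegative, as monotone convergence requires. *)
Fixpoint max_affine (R : realType) (ab : nat -> R * R) n (s : R) : R :=
  (if n is m.+1 then Num.max (max_affine ab m s) ((ab m).1 * s + (ab m).2)
   else 0)%R.

Section max_affine.
Context (R : realType) (F : R -> \bar R) (ab : nat -> R * R).
Hypothesis hF : is_entropy_function F.
Hypothesis ab_minorant : forall n, affine_minorant F (ab n).1 (ab n).2.
Hypothesis ab_approx : forall s t : R, (0 <= s)%R -> t%:E < F s ->
  exists n, (t < (ab n).1 * s + (ab n).2)%R.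

Lemma max_affine_ge0 n s : (0 <= max_affine ab n s)%R.
Proof. by elim: n => [|n IH] //=; rewrite le_max IH. Qed.

Lemma max_affine_le n s : (0 <= s)%R -> (max_affine ab n s)%:E <= F s.
Proof.
move=> s0; elim: n => [|n IH] /=; first exact: (entropy_ge0 hF).
rewrite /Num.max; case: ifP => _ //; exact: ab_minorant.
Qed.

Lemma max_affine_nondecreasing s :
  {homo (fun n => (max_affine ab n s)%:E) : n m / (n <= m)%N >-> n <= m}.
Proof. by apply/nondecreasing_seqP => n; rewrite lee_fin/= le_max lexx. Qed.

Lemma max_affine_cvg s : (0 <= s)%R ->
  (fun n => (max_affine ab n s)%:E) @ \oo --> F s.
Proof.
move=> s0; suff -> : F s = ereal_sup (range (fun n => (max_affine ab n s)%:E)).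
  exact: ereal_nondecreasing_cvgn (@max_affine_nondecreasing s).
apply/eqP; rewrite eq_le; apply/andP; split; last first.
  by apply: ge_ereal_sup => _ [n _ <-]; exact: max_affine_le.
apply: lee_from_real => t /(ab_approx s0)[n tn].
apply: le_ereal_sup_tmp; exists (max_affine ab n.+1 s)%:E; first by exists n.+1.
by rewrite lee_fin/= le_max (ltW tn) orbT.
Qed.

Lemma measurable_max_affine d (T : measurableType d) (f : T -> R) n :
  measurable_fun setT f -> measurable_fun setT (fun x => max_affine ab n (f x)).
Proof.
move=> mf; elim: n => [|n IH] /=; first exact: measurable_cst.
apply: measurable_maxr => //; apply: measurable_funD;
  last exact: measurable_cst.
by apply: measurable_funM => //; exact: measurable_cst.
Qed.

End max_affine.

Section entropy_functional.
Context d (T : measurableType d) (R : realType) (F : R -> \bar R).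
Hypothesis hF : is_entropy_function F.
Variables (gamma mu : {finite_measure set T -> \bar R}).
Local Notation sigma := (leb_density gamma mu).
Local Notation gs := (leb_singular gamma mu).

(** The share of [A] in the entropy: at [A = setT] this is [entropy_functional]
    by unfolding. *)
Definition entropy_on (A : set T) : \bar R :=
  \int[mu]_(x in A) F (sigma x) + recession F * gs A.

Let msigma : measurable_fun setT sigma.
Proof. by have [] := lebesgue_decompositionP gamma mu. Qed.

Let sigma_ge0 x : (0 <= sigma x)%R.
Proof. by have [_ h _ _] := lebesgue_decompositionP gamma mu; exact: h. Qed.

Let gammaE A : measurable A -> gamma A = \int[mu]_(x in A) (sigma x)%:E + gs A.
Proof. by have [_ _ _ h] := lebesgue_decompositionP gamma mu; exact: h. Qed.

Let Fsigma_ge0 x : 0 <= F (sigma x).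
Proof. exact: (entropy_ge0 hF). Qed.

Lemma measurable_entropy_density : measurable_fun setT (fun x => F (sigma x)).
Proof.
have [ab [ab1 ab2 _]] := affine_minorant_sequence hF.
apply: (@emeasurable_fun_cvg _ _ _ _ (fun n x =>
  (max_affine ab n (sigma x))%:E)).
  by move=> n; apply/measurable_EFinP; exact: measurable_max_affine.
by move=> x _; exact: max_affine_cvg.
Qed.

Let mF A : measurable_fun A (fun x => F (sigma x)).
Proof. exact: measurable_funTS measurable_entropy_density. Qed.

Lemma entropy_on_ge0 A : 0 <= entropy_on A.
Proof.
by rewrite adde_ge0 ?integral_ge0// mule_ge0// recession_ge0.
Qed.

Lemma entropy_onU A B : measurable A -> measurable B -> A `&` B = set0 ->
  entropy_on (A `|` B) = entropy_on A + entropy_on B.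
Proof.
move=> mA mB AB; rewrite /entropy_on ge0_integral_setU//; last first.
  by rewrite disj_set2E AB.
rewrite measureU// ge0_muleDr// addeACA//.
Qed.

Lemma subset_entropy_on A B : measurable A -> measurable B -> A `<=` B ->
  entropy_on A <= entropy_on B.
Proof.
move=> mA mB AB; rewrite -[B](setDUK AB) entropy_onU ?leeDl ?entropy_on_ge0//.
  exact: measurableD.
by rewrite setDIK.
Qed.

Let sigma_fin A : measurable A -> \int[mu]_(x in A) (sigma x)%:E \is a fin_num.
Proof.
move=> mA; rewrite ge0_fin_numE; last by apply: integral_ge0 => x _;
  rewrite lee_fin.
apply: (@le_lt_trans _ _ (gamma A)); first by rewrite gammaE// leeDl.
by rewrite -ge0_fin_numE// fin_num_measure.
Qed.

Let integrable_sigma A : measurable A -> mu.-integrable A (EFin \o sigma).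
Proof.
move=> mA; apply/integrableP; split.
  by apply/measurable_EFinP; exact: measurable_funTS.
under eq_integral do rewrite gee0_abs ?lee_fin//.
by rewrite -ge0_fin_numE ?sigma_fin// integral_ge0// => x _; rewrite lee_fin.
Qed.

Let integral_affine A (a b : R) : measurable A ->
  \int[mu]_(x in A) (a * sigma x + b)%:E =
  a%:E * (\int[mu]_(x in A) (sigma x)%:E) + b%:E * mu A.
Proof.
move=> mA; under eq_integral do rewrite EFinD EFinM.
rewrite integralD//; last exact: finite_measure_integrable_cst.
  rewrite integral_cst// integralZl//; exact: integrable_sigma.
by apply: integrableZl => //; exact: integrable_sigma.
Qed.

(** On the absolutely continuous part the minorant is applied under the
    integral, on the singular part its slope is compared with the recession
    constant. *)
Lemma entropy_on_ge (a b : R) A : affine_minorant F a b -> measurable A ->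
  a%:E * gamma A + b%:E * mu A <= entropy_on A.
Proof.
move=> mab mA; rewrite gammaE// muleDr//; last first.
  by rewrite fin_num_adde_defr// sigma_fin.
rewrite addeAC -integral_affine//; apply: leeD; last first.
  by apply: lee_wpmul2r => //; exact: (affine_minorant_slope_le hF mab).
rewrite integralE; apply: (@le_trans _ _ (\int[mu]_(x in A)
    (fun x => (a * sigma x + b)%:E)^\+ x)).
  by rewrite -[leRHS]adde0 leeD2l// leeNl oppe0 integral_ge0.
apply: ge0_le_integral => //.
  apply: measurable_funepos; apply/measurable_EFinP.
  apply: measurable_funD; last exact: measurable_cst.
  by apply: measurable_funM; [exact: measurable_cst|exact: measurable_funTS].
by move=> x _; rewrite funeposE ge_max Fsigma_ge0 andbT; exact: mab.
Qed.

(** The hypotheses on [m] involve [gamma] and [mu] but not the decomposition of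
    [gamma], which is what makes lower limits and convex combinations tractable.
    Off the singular set [N] the maxima of finitely many minorants are handled
    one minorant at a time, cutting along the set where it beats the previous
    ones; on [N] only the slopes contribute. *)
Lemma entropy_functional_le (m : set T -> \bar R) :
  (forall A, measurable A -> 0 <= m A) ->
  (forall A B, measurable A -> measurable B -> A `&` B = set0 ->
    m A + m B <= m (A `|` B)) ->
  (forall a b A, affine_minorant F a b -> measurable A ->
    a%:E * gamma A + b%:E * mu A <= m A) ->
  entropy_functional F gamma mu <= m setT.
Proof.
move=> m0 mU mge; have [ab [ab1 ab2 ab3]] := affine_minorant_sequence hF.
have [_ _ [N [mN gN muN]] _] := lebesgue_decompositionP gamma mu.
rewrite -/gs in gN.
have mNc : measurable (~` N) by exact: measurableC.
have mh n A : measurable_fun A (fun x => (max_affine ab n (sigma x))%:E).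
  by apply/measurable_EFinP; apply: measurable_funTS;
    exact: measurable_max_affine.
have gs0 A : measurable A -> A `<=` ~` N -> gs A = 0.
  by move=> mA AN; exact: subset_measure0 gN.
have step n A : measurable A -> A `<=` ~` N ->
    \int[mu]_(x in A) (max_affine ab n (sigma x))%:E <= m A.
  elim: n A => [|n IH] A mA AN /=; first by rewrite integral0 m0.
  pose g x := ((ab n).1 * sigma x + (ab n).2)%R.
  have mg : measurable_fun setT g.
    apply: measurable_funD; last exact: measurable_cst.
    by apply: measurable_funM; [exact: measurable_cst|].
  pose B := [set x | (max_affine ab n (sigma x) < g x)%R].
  have mB : measurable B.
    rewrite -[B]setTI; have mhn := measurable_max_affine ab n msigma.
    by apply: (measurable_fun_ltr mhn mg measurableT (Y := [set true])).
  have mAB : measurable (A `&` B) by exact: measurableI.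
  have mAB' : measurable (A `\` B) by exact: measurableD.
  have dAB : (A `&` B) `&` (A `\` B) = set0.
    by apply/seteqP; split => // x [[_ Bx] [_]].
  apply: (@le_trans _ _ (m (A `&` B) + m (A `\` B))); last first.
    by rewrite (le_trans (mU _ _ mAB mAB' dAB))// setUIDK.
  rewrite -[in leLHS](setUIDK A B) ge0_integral_setU//; last 3 first.
  - exact: (mh n.+1).
  - by move=> x _; rewrite lee_fin; exact: (max_affine_ge0 ab n.+1).
  - by rewrite disj_set2E dAB.
  apply: leeD.
    rewrite (eq_integral (EFin \o g)); last first.
      by move=> x /set_mem[_ Bx]; rewrite /= max_r// ltW.
    rewrite integral_affine//; apply: le_trans (mge _ _ _ (ab1 n) mAB).
    rewrite gammaE// (gs0 _ mAB) ?adde0//.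
    by apply: subset_trans AN; exact: subIsetl.
  rewrite (eq_integral (fun x => (max_affine ab n (sigma x))%:E)); last first.
    by move=> x /set_mem[_ /negP]; rewrite -leNgt => Bx; rewrite max_l.
  by apply: IH => //; apply: subset_trans AN; exact: subDsetl.
have regular : \int[mu]_(x in ~` N) F (sigma x) <= m (~` N).
  rewrite (eq_integral (fun x => limn (fun n =>
    (max_affine ab n (sigma x))%:E))); last first.
    by move=> x _; apply/esym/cvg_lim => //; exact: max_affine_cvg.
  rewrite monotone_convergence//.
  - apply: lime_le; last by apply: nearW => n; exact: step.
    apply: ereal_nondecreasing_is_cvgn => n k nk; apply: ge0_le_integral => //.
    + by move=> x _; rewrite lee_fin max_affine_ge0.
    + by move=> x _; exact: max_affine_nondecreasing.
  - by move=> n x _; rewrite lee_fin max_affine_ge0.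
  - by move=> x _; exact: max_affine_nondecreasing.
have muintN (f : T -> \bar R) : measurable_fun N f -> \int[mu]_(x in N) f x = 0.
  by move=> mf; exact: null_set_integral.
have singular : recession F * gs N <= m N.
  have [->|gN0] := eqVneq (gs N) 0; first by rewrite mule0 m0.
  have gN_gt0 : 0 < gs N by rewrite lt_neqAle eq_sym gN0 measure_ge0.
  have gN_fin : gs N \is a fin_num by exact: fin_num_measure.
  have fgN : (0 < fine (gs N))%R by rewrite fine_gt0// gN_gt0/= -ge0_fin_numE.
  rewrite -(fineK gN_fin) -lee_pdivlMr//. apply: lee_from_real => t /ab3[n tn].
  rewrite lee_pdivlMr//; apply: le_trans (mge _ _ _ (ab1 n) mN).
  rewrite muN mule0 adde0 gammaE// muintN; last first.
    by apply/measurable_EFinP; exact: measurable_funTS.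
  rewrite add0e -[in leRHS](fineK gN_fin).
  by rewrite -!EFinM lee_fin ler_wpM2r// ltW.
rewrite /entropy_functional.
have -> : \int[mu]_x F (sigma x) = \int[mu]_(x in ~` N) F (sigma x).
  rewrite -(setvU N) ge0_integral_setU//; last by rewrite disj_set2E setICl.
  by rewrite (muintN (fun x => F (sigma x))) ?adde0.
have -> : gs setT = gs N.
  transitivity (gs (~` N) + gs N); last by rewrite gN add0e.
  by rewrite -measureU ?setvU// setICl.
apply: (le_trans (leeD regular singular)).
by apply: (le_trans (mU _ _ mNc mN _)); rewrite ?setICl// setvU.
Qed.

End entropy_functional.

(** * Lower semicontinuity and convexity of the entropy *)

Section entropy_lsc.
Context (R : realType) (X : ptopologicalType) (F : R -> \bar R).
Hypotheses (hX : hausdorff_space X) (hF : is_entropy_function F).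
Context (T : choiceType) (I : filteredType T) (U : set_system I).
Context (PU : ProperFilter U).
Variables (nu : I -> {finite_measure set (borel X) -> \bar R}).
Variables (g mu : {finite_measure set (borel X) -> \bar R}).
Hypotheses (g_radon : is_radon g) (mu_radon : is_radon mu).
Hypothesis nu_g : portmanteau_limit U nu g.

Let lam (A : set X) := limf_einf (fun i => entropy_on F (nu i) mu A) U.

Let fineE (m : {finite_measure set (borel X) -> \bar R}) (A : set (borel X)) :
  measurable A -> m A = (fine (m A))%:E.
Proof. by move=> mA; rewrite fineK// fin_num_measure. Qed.

Let ob (G : set X) : open G -> measurable (G : set (borel X)).
Proof. exact: open_borel_measurable. Qed.

(** For nonnegative [a] the masses of an open neighbourhood of [K] are bounded
    below, and the neighbourhood is taken with little [mu]-mass outside [K].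
    For negative [a] an upper bound on the masses of [K] is needed; it follows
    from the lower bound on the complement and the upper bound on the total
    mass. *)
Lemma affine_le_open_hull (a b : R) (K : set X) : affine_minorant F a b ->
  compact K -> a%:E * g K + b%:E * mu K <= open_hull lam K.
Proof.
move=> mab cK; apply: open_hull_ge => G oG KG.
have mK := compact_borel hX cK; have mG := ob oG.
have [Ug UT] := nu_g.
apply/lee_addgt0Pr => e e0.
pose d := (e / (2 * `|a| + `|b| + 1))%R.
have D0 : (0 < 2 * `|a| + `|b| + 1)%R.
  by have := normr_ge0 a; have := normr_ge0 b; lra.
have d0 : (0 < d)%R by rewrite divr_gt0.
have de : (d * (2 * `|a| + `|b| + 1) = e)%R by rewrite /d divfK// gt_eqF.
rewrite -leeBlDr//; apply: limf_einf_ge.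
rewrite (fineE g mK) (fineE mu mK) -!EFinM -EFinD.
have [a0|a0] := leP 0%R a.
- have [L [cL LGK Ld]] := mu_radon (measurableD mG mK) d0.
  pose G' := G `\` L.
  have oG' : open G'.
    by apply: openI => //; apply: closed_openC; exact: compact_closed.
  have mG' := ob oG'.
  have KG' : K `<=` G' by move=> x Kx; split; [exact: KG|move=> /LGK[]].
  have muG' : (fine (mu K) <= fine (mu G') <= fine (mu K) + d)%R.
    rewrite -!lee_fin EFinD -!fineE//; apply/andP; split.
      by apply: le_measure => //; exact: mem_set.
    rewrite -[G'](setDUK KG') measureU//; last 2 first.
    + exact: measurableD.
    + by rewrite setDIK.
    rewrite leeD2l//; apply: le_trans Ld; apply: le_measure.
    + by apply: mem_set; exact: measurableD.
    + apply: mem_set; apply: measurableD; first exact: measurableD mG mK.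
      exact: compact_borel.
    + by move=> x [[Gx Lx] Kx].
  have /limf_einf_gt UG' : (fine (g K) - d)%:E < limf_einf (fun i => nu i G') U.
    apply: lt_le_trans (Ug _ oG'); apply: (@lt_le_trans _ _ (g K)).
      by rewrite (fineE g mK) lte_fin; lra.
    by apply: le_measure => //; exact: mem_set.
  apply: filterS UG' => i /= nuG'.
  apply: (@le_trans _ _ (entropy_on F (nu i) mu G')); last first.
    by apply: subset_entropy_on => // x [].
  apply: le_trans (entropy_on_ge hF (nu i) mu mab mG').
  move: nuG'; rewrite (fineE (nu i) mG') (fineE mu mG') -!EFinM -EFinD
    lte_fin lee_fin.
  move=> nuG'.
  have h1 : (a * (fine (g K) - d) <= a * fine (nu i G'))%R
    by rewrite ler_wpM2l// ltW.
  have h2 : (`|b * (fine (mu G') - fine (mu K))| <= `|b| * d)%R.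
    by rewrite normrM ler_wpM2l// ger0_norm; lra.
  move: h2; rewrite ler_norml => /andP[h2 _].
  rewrite ger0_norm// in de; have : (0 <= a * d)%R by rewrite mulr_ge0// ltW.
  lra.
- have oK : open (~` K) by apply: closed_openC; exact: compact_closed.
  have mKc := ob oK.
  have split_mass (m : {finite_measure set (borel X) -> \bar R}) :
      (fine (m setT) = fine (m K) + fine (m (~` K)))%R.
    apply: EFin_inj; rewrite EFinD -!fineE//.
    by rewrite -measureU ?setUv// setICr.
  have /limf_einf_gt UK : (fine (g (~` K)) - d)%:E <
      limf_einf (fun i => nu i (~` K)) U.
    by apply: lt_le_trans (Ug _ oK); rewrite (fineE g mKc) lte_fin; lra.
  apply: filterS (filterI UK (UT _ d0)) => i [/=].
  rewrite (fineE (nu i) mKc) (fineE (nu i) measurableT) (fineE g measurableT).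
  rewrite -EFinD lte_fin lee_fin (split_mass g) (split_mass (nu i)) => h1 h2.
  apply: (@le_trans _ _ (entropy_on F (nu i) mu K)); last first.
    exact: subset_entropy_on.
  apply: le_trans (entropy_on_ge hF (nu i) mu mab mK).
  rewrite (fineE (nu i) mK) (fineE mu mK) -!EFinM -EFinD lee_fin.
  have h3 : (a * (fine (g K) + 2 * d) <= a * fine (nu i K))%R.
    by rewrite ler_wnM2l; lra.
  rewrite ltr0_norm// in de.
  have : (0 <= `|b| * d)%R by rewrite mulr_ge0// ltW.
  lra.
Qed.

(** Both [g] and [mu] are inner regular, so a compact part of [A] carries
    almost all of both masses. *)
Lemma affine_le_inner_content (a b : R) (A : set (borel X)) :
  affine_minorant F a b -> measurable A ->
  a%:E * g A + b%:E * mu A <= inner_content lam A.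
Proof.
move=> mab mA; apply/lee_addgt0Pr => e e0.
pose d := (e / (`|a| + `|b| + 1))%R.
have D0 : (0 < `|a| + `|b| + 1)%R.
  by have := normr_ge0 a; have := normr_ge0 b; lra.
have d0 : (0 < d)%R by rewrite divr_gt0.
have de : (d * (`|a| + `|b| + 1) = e)%R by rewrite /d divfK// gt_eqF.
have [K1 [cK1 K1A gK1]] := g_radon mA d0.
have [K2 [cK2 K2A muK2]] := mu_radon mA d0.
pose K := K1 `|` K2; have cK : compact K by exact: compactU.
have mK := compact_borel hX cK.
have KA : K `<=` A by move=> x [/K1A|/K2A].
have approx (m : {finite_measure set (borel X) -> \bar R}) K' : K' `<=` K ->
    measurable (K' : set (borel X)) -> m (A `\` K') <= d%:E ->
    (fine (m K) <= fine (m A) <= fine (m K) + d)%R.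
  move=> K'K mK' K'd; rewrite -!lee_fin EFinD -!fineE//; apply/andP; split.
    by apply: le_measure => //; exact: mem_set.
  rewrite -[A](setDUK KA) measureU//; last 2 first.
  - exact: measurableD mA mK.
  - by rewrite setDIK.
  rewrite leeD2l//; apply: le_trans K'd; apply: le_measure.
  - by apply: mem_set; exact: measurableD mA mK.
  - by apply: mem_set; exact: measurableD mA mK'.
  - by move=> x [Ax Kx]; split => // /K'K.
have gK := approx g _ (@subsetUl _ K1 K2) (compact_borel hX cK1) gK1.
have muK := approx mu _ (@subsetUr _ K1 K2) (compact_borel hX cK2) muK2.
apply: (@le_trans _ _ (a%:E * g K + b%:E * mu K + e%:E)); last first.
  rewrite leeD2r//; apply: (le_trans (affine_le_open_hull mab cK)).
  exact: inner_content_ge.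
rewrite (fineE g mK) (fineE mu mK) (fineE g mA) (fineE mu mA) -!EFinM -!EFinD
  lee_fin.
have h (z x y : R) : (x <= y <= x + d)%R -> (z * y <= z * x + `|z| * d)%R.
  move=> /andP[xy yx]; have : (`|z * (y - x)| <= `|z| * d)%R.
    by rewrite normrM ler_wpM2l// ger0_norm; lra.
  by rewrite ler_norml => /andP[_]; lra.
have := h a _ _ gK; have := h b _ _ muK; lra.
Qed.

Lemma entropy_functional_limf_einf : entropy_functional F g mu <=
  limf_einf (fun i => entropy_functional F (nu i) mu) U.
Proof.
have lam_ge0 A : 0 <= lam A.
  by apply: limf_einf_ge0 => i; exact: entropy_on_ge0.
have lam_mono G H : open G -> open H -> G `<=` H -> lam G <= lam H.
  move=> oG oH GH; apply: le_limf_einf; apply: filterE => i /=.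
  by apply: subset_entropy_on => //; exact: ob.
have lam_superadd G H : open G -> open H -> G `&` H = set0 ->
    lam G + lam H <= lam (G `|` H).
  move=> oG oH GH; apply: (le_trans (limf_einfD _ _ _)).
  apply: le_limf_einf; apply: filterE => i /=.
  by rewrite entropy_onU//; exact: ob.
apply: (@le_trans _ _ (inner_content lam setT)).
  apply: entropy_functional_le => //.
  - by move=> A _; exact: inner_content_ge0.
  - by move=> A B _ _; exact: inner_content_superadd.
  - by move=> a b A; exact: affine_le_inner_content.
by apply: inner_content_le_open; exact: openT.
Qed.

End entropy_lsc.

Section entropy_convex.
Context d (T : measurableType d) (R : realType) (F : R -> \bar R).
Hypothesis hF : is_entropy_function F.

(** The convex combination of the localized entropies of [g0] and [g1] is a
    superadditive majorant for [g]. *)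
Lemma entropy_functional_convex (g0 g1 g mu : {finite_measure set T -> \bar R})
    (t : R) : (0 <= t <= 1)%R ->
  (forall A, measurable A -> g A = t%:E * g0 A + (1 - t)%:E * g1 A) ->
  entropy_functional F g mu <=
  t%:E * entropy_functional F g0 mu + (1 - t)%:E * entropy_functional F g1 mu.
Proof.
move=> /andP[t0 t1] gE.
have t1' : (0 <= 1 - t)%R by lra.
pose m A := t%:E * entropy_on F g0 mu A + (1 - t)%:E * entropy_on F g1 mu A.
apply: (@entropy_functional_le _ _ _ _ _ _ _ m) => //.
- by move=> A _; rewrite adde_ge0// mule_ge0 ?lee_fin// entropy_on_ge0.
- move=> A B mA mB AB; have e0 g' C := entropy_on_ge0 hF g' mu C.
  by rewrite /m !entropy_onU// (ge0_muleDr _ (e0 _ _) (e0 _ _))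
    (ge0_muleDr _ (e0 _ _) (e0 _ _)) addeACA.
- move=> a b A mab mA; have fineE (n : {finite_measure set T -> \bar R}) :
      n A = (fine (n A))%:E by rewrite fineK// fin_num_measure.
  apply: (@le_trans _ _ (t%:E * (a%:E * g0 A + b%:E * mu A) +
      (1 - t)%:E * (a%:E * g1 A + b%:E * mu A))).
    rewrite gE// (fineE g0) (fineE g1) (fineE mu) -!(EFinM, EFinD) lee_fin.
    by lra.
  by apply: leeD; apply: lee_wpmul2l; rewrite ?lee_fin//; exact: entropy_on_ge.
Qed.

Lemma entropy_functional_ge0 (g mu : {finite_measure set T -> \bar R}) :
  0 <= entropy_functional F g mu.
Proof. exact: (entropy_on_ge0 hF g mu setT). Qed.

Lemma entropy_functional_mass (g mu : {finite_measure set T -> \bar R})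
    (a b C : R) A : (0 < a)%R -> affine_minorant F a b -> measurable A ->
  entropy_functional F g mu <= C%:E ->
  g A <= ((C + `|b| * fine (mu A)) / a)%:E.
Proof.
move=> a0 mab mA gC.
have fineE (n : {finite_measure set T -> \bar R}) :
  n A = (fine (n A))%:E by rewrite fineK// fin_num_measure.
have := le_trans (subset_entropy_on hF g mu mA measurableT (@subsetT _ A)) gC.
move=> /(le_trans (entropy_on_ge hF g mu mab mA)).
rewrite (fineE g) (fineE mu) -!EFinM -!EFinD !lee_fin ler_pdivlMr// => h.
have : (- (`|b| * fine (mu A)) <= b * fine (mu A))%R.
  by rewrite -mulNr ler_wpM2r ?fine_ge0// lerNl -normrN ler_norm.
rewrite fineE/=; lra.
Qed.

End entropy_convex.

Section convex_combination.
Context (R : realType) (X : ptopologicalType).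
Hypothesis hX : hausdorff_space X.

Lemma radon_convex_combination (t : R) (mu nu : radon_measure R X) :
  (0 <= t <= 1)%R -> exists la : radon_measure R X,
  (forall A : set (borel X), measurable A ->
    la A = t%:E * mu A + (1 - t)%:E * nu A) /\
  forall f : X -> \bar R, (forall x, 0 <= f x) -> lower_semicontinuous f ->
    \int[la]_(x in [set: borel X]) f x =
    t%:E * \int[mu]_(x in [set: borel X]) f x +
    (1 - t)%:E * \int[nu]_(x in [set: borel X]) f x.
Proof.
move=> /andP[t0 t1]; have t1' : (0 <= 1 - t)%R by lra.
pose la : {finite_measure set (borel X) -> \bar R} :=
  measure_add (mscale (NngNum t0) mu) (mscale (NngNum t1') nu).
have laE A : la A = t%:E * mu A + (1 - t)%:E * nu A
  by rewrite /la/= measure_addE.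
have la_radon : is_radon la.
  move=> B e mB e0.
  have [K [cK KB Ke]] := radon_measureP mu mB e0.
  have [L [cL LB Le]] := radon_measureP nu mB e0.
  have mK := compact_borel hX cK; have mL := compact_borel hX cL.
  have mKL := measurableU _ _ mK mL.
  exists (K `|` L); split; [exact: compactU|by move=> x [/KB|/LB]|].
  rewrite [leLHS]laE; apply: (@le_trans _ _ (t%:E * e%:E + (1 - t)%:E * e%:E)).
    apply: leeD; apply: lee_wpmul2l; rewrite ?lee_fin//.
    - apply: le_trans Ke; apply: le_measure.
      + by apply: mem_set; exact: measurableD mB mKL.
      + by apply: mem_set; exact: measurableD mB mK.
      + by move=> x [Bx KLx]; split => // Kx; apply: KLx; left.
    - apply: le_trans Le; apply: le_measure.
      + by apply: mem_set; exact: measurableD mB mKL.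
      + by apply: mem_set; exact: measurableD mB mL.
      + by move=> x [Bx KLx]; split => // Kx; apply: KLx; right.
  by rewrite -!EFinM -EFinD lee_fin; lra.
exists (RadonMeasure la_radon); split; first by move=> A _; exact: laE.
move=> f f0 lf; have mf := measurable_lsc lf.
by rewrite ge0_integral_measure_add// !ge0_integral_mscale.
Qed.

End convex_combination.

(** * Tightness of sublevel sets and existence of minimizers *)

Section tightness.
Context (R : realType) (X : ptopologicalType) (F : R -> \bar R).
Hypotheses (hX : hausdorff_space X) (hF : is_entropy_function F).
Variable mu : radon_measure R X.

(** With a slope [a >= 2 |C| / e] the term [C / a] of [entropy_functional_mass]
    is at most [e / 2]; then [K] is chosen for [mu], given [a] and [b]. *)
Lemma superlinear_tight (C e : R) : recession F = +oo -> (0 < e)%R ->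
  exists2 K : set X, compact K &
    forall g : {finite_measure set (borel X) -> \bar R},
      entropy_functional F g mu <= C%:E -> g (~` K) <= e%:E.
Proof.
move=> Fy e0.
have [|a [b [mab ha]]] := @affine_minorant_slope_gt _ _ hF (2 * `|C| / e)%R.
  by rewrite Fy ltry.
have a0 : (0 < a)%R by apply: le_lt_trans ha; rewrite divr_ge0 ?mulr_ge0// ltW.
pose dl := (e * a / (2 * (`|b| + 1)))%R.
have b0 : (0 < 2 * (`|b| + 1))%R by have := normr_ge0 b; lra.
have dl0 : (0 < dl)%R by rewrite divr_gt0// mulr_gt0.
have dlE : (dl * (2 * (`|b| + 1)) = e * a)%R by rewrite /dl divfK// gt_eqF.
have [K [cK _ Kd]] := radon_measureP mu measurableT dl0.
exists K => // g gC.
have mK : measurable (~` K : set (borel X)).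
  by apply: measurableC; exact: compact_borel.
apply: (le_trans (entropy_functional_mass hF a0 mab mK gC)).
rewrite lee_fin ler_pdivrMr//.
move: Kd; rewrite setTD -(fineK (fin_num_measure mu _ mK)) lee_fin => Kd.
have : (`|b| * fine (mu (~` K)) <= `|b| * dl)%R by rewrite ler_wpM2l.
move: ha; rewrite ltr_pdivrMr// => ha.
have := ler_norm C; lra.
Qed.

Lemma entropy_mass_bounded (C : R) : 0 < recession F -> exists D : R,
  forall g : {finite_measure set (borel X) -> \bar R},
    entropy_functional F g mu <= C%:E -> g setT <= D%:E.
Proof.
move=> /(affine_minorant_slope_gt hF)[a [b [mab a0]]].
exists ((C + `|b| * fine (mu setT)) / a)%R => g.
exact: (entropy_functional_mass hF a0 mab measurableT).
Qed.

End tightness.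

Section entropy_transport.
Context (R : realType) (X1 X2 : ptopologicalType).
Hypotheses (hX1 : hausdorff_space X1) (hX2 : hausdorff_space X2).
Variables (F1 F2 : R -> \bar R) (c : X1 * X2 -> \bar R).
Hypotheses (hF1 : is_entropy_function F1) (hF2 : is_entropy_function F2).
Hypotheses (c_ge0 : forall x, 0 <= c x) (c_lsc : lower_semicontinuous c).
Variables (mu1 : radon_measure R X1) (mu2 : radon_measure R X2).
Notation X := (X1 * X2)%type.
Notation M := (radon_measure R X).
Notation E := (ET_functional F1 F2 c mu1 mu2).

Let hX : hausdorff_space X := hausdorff_prod hX1 hX2.

Let int_ge0 (g : M) : 0 <= \int[g]_(x in [set: borel X]) c x.
Proof. by apply: integral_ge0. Qed.

Lemma ET_functional_ge0 g : 0 <= E g.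
Proof.
by apply: adde_ge0 => //; apply: adde_ge0; exact: entropy_functional_ge0.
Qed.

Lemma ET_functional_bounds (g : M) (C : R) : E g <= C%:E ->
  [/\ entropy_functional F1 (marginal1 g) mu1 <= C%:E,
      entropy_functional F2 (marginal2 g) mu2 <= C%:E &
      \int[g]_(x in [set: borel X]) c x <= C%:E].
Proof.
have e1 := entropy_functional_ge0 hF1 (marginal1 g) mu1.
have e2 := entropy_functional_ge0 hF2 (marginal2 g) mu2.
move=> gC; split; apply: le_trans gC; rewrite /ET_functional.
- by rewrite -addeA leeDl// adde_ge0.
- by rewrite addeAC leeDr// adde_ge0.
- by rewrite leeDr// adde_ge0.
Qed.

Lemma ET_functional_limf_einf (U : set_system M) (g : M) : ProperFilter U ->
  portmanteau_limit U (@radon_fmeas R X) g -> E g <= limf_einf E U.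
Proof.
move=> PU Ug.
have h1 := entropy_functional_limf_einf hX1 hF1 PU
  (continuous_image_radon hX hX1 (@continuous_fst X1 X2) g) (radon_measureP mu1)
  (continuous_image_portmanteau (@continuous_fst X1 X2) Ug).
have h2 := entropy_functional_limf_einf hX2 hF2 PU
  (continuous_image_radon hX hX2 (@continuous_snd X1 X2) g) (radon_measureP mu2)
  (continuous_image_portmanteau (@continuous_snd X1 X2) Ug).
have h3 := integral_lsc_limf_einf PU Ug c_ge0 c_lsc.
rewrite /ET_functional.
apply: (le_trans (leeD (leeD h1 h2) h3)).
apply: le_trans (limf_einfD _ _ _).
by rewrite leeD2r//; exact: limf_einfD.
Qed.

(** Markov's inequality for [c]. *)
Lemma cost_tight (e C : R) : compact_sublevels c -> (0 < e)%R ->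
  exists2 K : set X, compact K &
    forall g : M, E g <= C%:E -> g (~` K) <= e%:E.
Proof.
move=> cc e0; pose a := ((`|C| + 1) / e)%R.
have a0 : (0 < a)%R by rewrite divr_gt0// ltr_wpDl.
(* The summand 1 in [a] keeps [a] positive when [C] is 0. *)
exists [set x | c x <= a%:E]; first exact: cc.
move=> g /ET_functional_bounds[_ _ gC].
set A := ~` _.
have AE : A = [set x | a%:E < c x].
  by apply/seteqP; split => x /=; rewrite ltNge => /negP.
have mA : measurable (A : set (borel X)).
  by rewrite AE; apply: open_borel_measurable;
    move/lower_semicontinuousP : c_lsc; exact.
have : a%:E * g A <= C%:E.
  apply: le_trans gC; rewrite -integral_cst//.
  have mc := measurable_lsc c_lsc.
  apply: (@le_trans _ _ (\int[g]_(x in A) c x)).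
    apply: ge0_le_integral => //.
    - by move=> x _; rewrite lee_fin ltW.
    - exact: measurable_funTS.
    - by move=> x; rewrite AE => /ltW.
  by apply: ge0_subset_integral.
rewrite -(fineK (fin_num_measure g _ mA)) -EFinM !lee_fin => h.
rewrite -(ler_pM2l a0); apply: (le_trans h).
by rewrite /a divfK ?gt_eqF// (le_trans (ler_norm _))// lerDl.
Qed.

Hypothesis hcoercive :
  (recession F1 = +oo /\ recession F2 = +oo) \/
  (compact_sublevels c /\
   0 < recession F1 + recession F2 + ereal_inf (range c)).

Lemma ET_tight (C e : R) : (0 < e)%R ->
  exists2 K : set X, compact K &
    forall g : M, E g <= C%:E -> g (~` K) <= e%:E.
Proof.
move=> e0; case: hcoercive => [[F1y F2y]|[cc _]]; last exact: cost_tight.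
have e20 : (0 < e / 2)%R by rewrite divr_gt0.
have [K1 cK1 K1e] := superlinear_tight hX1 hF1 mu1 C F1y e20.
have [K2 cK2 K2e] := superlinear_tight hX2 hF2 mu2 C F2y e20.
exists (K1 `*` K2); first exact: compact_setX.
move=> g /ET_functional_bounds[/K1e h1 /K2e h2 _].
have mpre (Y : ptopologicalType) (f : X -> Y) (K : set Y) : hausdorff_space Y ->
    continuous f -> compact K -> measurable (f @^-1` (~` K) : set (borel X)).
  move=> hY cf cK; apply: open_borel_measurable; apply: open_comp.
    by move=> x _; exact: cf.
  by apply: closed_openC; exact: compact_closed.
have m1 := mpre _ fst K1 hX1 (@continuous_fst X1 X2) cK1.
have m2 := mpre _ snd K2 hX2 (@continuous_snd X1 X2) cK2.
apply: (@le_trans _ _ (g (fst @^-1` (~` K1) `|` snd @^-1` (~` K2)))).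
  apply: le_measure.
  - apply: mem_set; apply: measurableC; apply: compact_borel => //.
    exact: compact_setX.
  - by apply: mem_set; exact: measurableU.
  - move=> [x y] /= /not_andP; tauto.
apply: (le_trans (measureU2 _ m1 m2)).
by rewrite (splitr e) EFinD; apply: leeD.
Qed.

(** Each of the two recession constants and the infimum of the cost bounds the
    mass as soon as it is positive. *)
Lemma ET_mass (C : R) : exists D : R, forall g : M, E g <= C%:E ->
  g setT <= D%:E.
Proof.
have mass1 : 0 < recession F1 -> exists D : R, forall g : M, E g <= C%:E ->
  g setT <= D%:E.
  move=> /(entropy_mass_bounded hF1 mu1 C)[D hD]; exists D.
  by move=> g /ET_functional_bounds[/hD].
have mass2 : 0 < recession F2 -> exists D : R, forall g : M, E g <= C%:E ->
  g setT <= D%:E.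
  move=> /(entropy_mass_bounded hF2 mu2 C)[D hD]; exists D.
  by move=> g /ET_functional_bounds[_ /hD].
case: hcoercive => [[F1y _]|[_ pos]]; first by apply: mass1; rewrite F1y ltry.
have r1 := recession_ge0 hF1; have r2 := recession_ge0 hF2.
have [/mass1//|r1'] := ltP 0 (recession F1).
have [/mass2//|r2'] := ltP 0 (recession F2).
have E1 : recession F1 = 0 by apply/eqP; rewrite eq_le r1 r1'.
have E2 : recession F2 = 0 by apply/eqP; rewrite eq_le r2 r2'.
move: pos; rewrite E1 E2 !add0e => pos.
have [r r0 rc] : exists2 r : R, (0 < r)%R & r%:E <= ereal_inf (range c).
  move: pos; case: (ereal_inf (range c)) => [r| |]//.
    by rewrite lte_fin => r0; exists r.
  by move=> _; exists 1%R; rewrite ?leey.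
exists (C / r)%R => g /ET_functional_bounds[_ _ gC].
have : r%:E * g setT <= C%:E.
  apply: le_trans gC; rewrite -integral_cst//; apply: ge0_le_integral => //.
  - by move=> x _; rewrite lee_fin ltW.
  - exact: measurable_lsc.
  - by move=> x _; apply: (le_trans rc); apply: ereal_inf_lbound; exists x.
rewrite -(fineK (fin_num_measure g _ measurableT)) -EFinM !lee_fin.
by rewrite ler_pdivlMr// mulrC.
Qed.

Lemma ET_ultra_limit (U : set_system M) (C : R) : UltraFilter U ->
  U [set g | E g <= C%:E] -> exists2 g : M, U --> g & E g <= limf_einf E U.
Proof.
move=> UU UC; have PU : ProperFilter U by exact: ultra_proper.
have [D hD] := ET_mass C.
have [||g Ug] := @prokhorov_ultra _ _ hX U UU.
- by exists D; apply: filterS UC => g /hD.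
- move=> e /(ET_tight C)[K cK hK]; exists K => //.
  by apply: filterS UC => g /hK.
exists g; first exact: portmanteau_cvg.
exact: ET_functional_limf_einf.
Qed.

Hypothesis hfeasible : exists g : M, E g < +oo.

Let inf_fin : ereal_inf (range E) \is a fin_num.
Proof.
rewrite ge0_fin_numE; last first.
  by apply: le_ereal_inf_tmp => _ [g _ <-]; exact: ET_functional_ge0.
have [g gy] := hfeasible; apply: le_lt_trans gy.
by apply: ereal_inf_lbound; exists g.
Qed.

Lemma ET_optE : ET_opt F1 F2 c mu1 mu2 = [set g | E g <= ereal_inf (range E)].
Proof.
apply/seteqP; split => g /= h; first by apply: le_ereal_inf_tmp => _ [g' _ <-].
by move=> g'; apply: (le_trans h); apply: ereal_inf_lbound; exists g'.
Qed.

(** The sublevel sets above the infimum form a filter base; the limit of an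
    ultrafilter that refines it lies in all of them. *)
Lemma ET_opt_nonempty : ET_opt F1 F2 c mu1 mu2 !=set0.
Proof.
pose r := fine (ereal_inf (range E)).
pose B (e : R) := [set g : M | E g <= (r + e)%:E].
pose D := [set e : R | (0 < e)%R].
have FF : ProperFilter (filter_from D B).
  apply: filter_from_proper.
    apply: filter_from_filter; first by exists 1%R; rewrite /D/=.
    move=> e1 e2 e10 e20; exists (Num.min e1 e2).
      by rewrite /D/= lt_min; apply/andP.
    move=> g; rewrite /B/= => h; split; apply: (le_trans h);
      by rewrite lee_fin lerD2l ge_min lexx ?orbT.
  move=> e e0; have [|_ [g _ <-] h] := @ereal_inf_lt _ (range E) (r + e)%:E.
    by rewrite EFinD fineK// lteDl.
  by exists g; exact: ltW.
have [U [UU FU]] := ultraFilterLemma FF.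
have UB e : (0 < e)%R -> U (B e) by move=> e0; apply: FU; exists e.
have [g _ gU] := ET_ultra_limit UU (UB _ ltr01).
exists g; rewrite ET_optE /=; apply: (le_trans gU).
apply/lee_addgt0Pr => e e0; rewrite -(fineK inf_fin) -EFinD.
by apply: limf_einf_le; exact: UB.
Qed.

Lemma ET_opt_compact : compact (ET_opt F1 F2 c mu1 mu2).
Proof.
rewrite compact_ultra => U UU; rewrite ET_optE -(fineK inf_fin) => UO.
have PU : ProperFilter U by exact: ultra_proper.
have [g Ug gU] := ET_ultra_limit UU UO.
by exists g; split => //=; apply: (le_trans gU); exact: limf_einf_le.
Qed.

Lemma ET_opt_convex : convex_measures (ET_opt F1 F2 c mu1 mu2).
Proof.
move=> t mu nu t01 omu onu.
have [la [laE laint]] := radon_convex_combination hX mu nu t01.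
exists la => // g'; have /andP[t0 t1] := t01.
have t1' : (0 <= 1 - t)%R by lra.
have pre (Y : ptopologicalType) (f : X ->
  Y) (cf : continuous f) (A : set (borel Y)) :
    measurable A -> measurable (f @^-1` A : set (borel X)).
  move=> mA; rewrite -[X in measurable X]setTI.
  exact: continuous_borel_measurable.
have h1 := entropy_functional_convex hF1 mu1 t01 (fun A mA =>
  laE _ (pre _ _ (@continuous_fst X1 X2) A mA)
    : marginal1 la A = t%:E * marginal1 mu A + (1 - t)%:E * marginal1 nu A).
have h2 := entropy_functional_convex hF2 mu2 t01 (fun A mA =>
  laE _ (pre _ _ (@continuous_snd X1 X2) A mA)
    : marginal2 la A = t%:E * marginal2 mu A + (1 - t)%:E * marginal2 nu A).
have e1 (g : M) := entropy_functional_ge0 hF1 (marginal1 g) mu1.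
have e2 (g : M) := entropy_functional_ge0 hF2 (marginal2 g) mu2.
apply: (@le_trans _ _ (t%:E * E mu + (1 - t)%:E * E nu)); last first.
  apply: (@le_trans _ _ (t%:E * E g' + (1 - t)%:E * E g')).
    by apply: leeD; apply: lee_wpmul2l; rewrite ?lee_fin.
  rewrite -ge0_muleDl ?lee_fin// -EFinD.
  by rewrite (_ : t + (1 - t) = 1)%R ?mul1e//; lra.
rewrite /ET_functional laint// !(ge0_muleDr _ (adde_ge0 (e1 _) (e2 _))
  (int_ge0 _)).
rewrite !(ge0_muleDr _ (e1 _) (e2 _)) [leRHS]addeACA; apply: leeD => //.
by rewrite [leRHS]addeACA; exact: leeD h1 h2.
Qed.

End entropy_transport.

Theorem theorem3p3 (R : realType) (X1 X2 : ptopologicalType)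
    (hX1 : hausdorff_space X1) (hX2 : hausdorff_space X2)
    (F1 F2 : R -> \bar R)
    (hF1 : is_entropy_function F1) (hF2 : is_entropy_function F2)
    (c : X1 * X2 -> \bar R)
    (c_ge0 : forall x, 0 <= c x)
    (c_lsc : lower_semicontinuous c)
    (c_proper : exists x, c x != +oo)
    (mu1 : radon_measure R X1) (mu2 : radon_measure R X2)
    (hcompat : compatible F1 F2 mu1 mu2)
    (hfeasible : exists gamma : radon_measure R (X1 * X2)%type,
       ET_functional F1 F2 c mu1 mu2 gamma < +oo)
    (hcoercive :
       (recession F1 = +oo /\ recession F2 = +oo) \/
       (compact_sublevels c /\
        0 < recession F1 + recession F2 + ereal_inf (range c))) :
  [/\ ET_opt F1 F2 c mu1 mu2 !=set0,
      compact (ET_opt F1 F2 c mu1 mu2) &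
      convex_measures (ET_opt F1 F2 c mu1 mu2)].
Proof.
split; [exact: ET_opt_nonempty|exact: ET_opt_compact|exact: ET_opt_convex].
Qed.
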